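(* Let $n\ge1$, let $a\in\mathbb{R}$ with $P_n(a)=\mathbb{P}(V_n(X_n)\ge a)>0$, and let $\varphi_n:F_n\to\mathbb{R}$ be bounded measurable. In the Feynman–Kac particle setting described in the context, $$N\,\mathbb{E}\big[(P_n^N(a,\varphi_n)-P_n(a,\varphi_n))\mathbf{1}_{P_n^N(a)>0}\big]\xrightarrow[N\to\infty]{}-P_n(a)^{-2}\sum_{p=1}^n\gamma_p(1)\,\gamma_p^-(1)\,\eta_p^-\big[P_{p,n}(a)\,P_{p,n}(a,\varphi_n)\big],$$ where $P_{p,n}(a)(x_0,\dots,x_p)=\mathbb{E}[\mathbf{1}_{V_n(X_n)\ge a}\mid X_p=x_p]$ and $$P_{p,n}(a,\varphi_n)(x_0,\dots,x_p)=\mathbb{E}\big[(\varphi_n(X_0,\dots,X_n)-P_n(a,\varphi_n))\mathbf{1}_{V_n(X_n)\ge a}\,\big|\,(X_0,\dots,X_p)=(x_0,\dots,x_p)\big].$$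
   Context: Markov chain. $(X_n)_{n\ge0}$ is a (nonhomogeneous) Markov chain with $X_n$ taking values in a measurable space $(E_n,\mathcal{E}_n)$, Markov transition kernels $K_n(x_{n-1},dx_n)$ from $E_{n-1}$ to $E_n$, and deterministic initial value $X_0=x_0$. $F_n=E_0\times\cdots\times E_n$ and $Y_n=(X_0,\dots,X_n)\in F_n$ is the historical process, with Markov transitions $M_n(y_{n-1},dy_n)$ (keep the path $y_{n-1}$ and append a point drawn from $K_n$ started at its last coordinate). $\mathcal{B}_b(F_n)$ is the space of bounded measurable real functions on $F_n$. $V_n:E_n\to\mathbb{R}$ is a measurable function. Conditional expectations given $X_p=x_p$ or $(X_0,\dots,X_p)=(x_0,\dots,x_p)$ are those given by the transition kernels. Potentials. $G_n:F_n\to(0,\infty)$, $n\ge1$, are measurable with $\sup_{(y,y')\in F_n^2}G_n(y)/G_n(y')<\infty$ for each $n$. Write $G_n^-=1/G_n$. Feynman–Kac measures. For $f_n\in\mathcal{B}_b(F_n)$, $n\ge1$: $\gamma_n(f_n)=\mathbb{E}[f_n(Y_n)\prod_{1\le k<n}G_k(Y_k)]$ and $\eta_n(f_n)=\gamma_n(f_n)/\gamma_n(1)$. The measures $\gamma_n^-,\eta_n^-$ are defined in the same way with each $G_k$ replaced by $G_k^-$. (Empty products equal $1$.) For $n\ge2$ and a probability measure $\mu$ on $F_{n-1}$, $\Phi_n(\mu)(dy_n)=\int_{F_{n-1}}\mu(dy_{n-1})G_{n-1}(y_{n-1})M_n(y_{n-1},dy_n)/\mu(G_{n-1})$; one has $\eta_1=M_1(x_0,\cdot)$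 and $\eta_n=\Phi_n(\eta_{n-1})$. Particle system. For each $N\ge1$, $\xi_n=(\xi_n^i)_{1\le i\le N}$, $n\ge1$, is a Markov chain with $\xi_n\in F_n^N$: $\xi_1^1,\dots,\xi_1^N$ are i.i.d. with law $\eta_1$, and for $n\ge2$, conditionally on $\xi_1,\dots,\xi_{n-1}$, the $\xi_n^1,\dots,\xi_n^N$ are i.i.d. with law $\Phi_n(\eta_{n-1}^N)$, where $\eta_n^N=\frac1N\sum_{i=1}^N\delta_{\xi_n^i}$. Rare event quantities and estimators. For $\varphi_n\in\mathcal{B}_b(F_n)$, $T_n^{(a)}(\varphi_n)(x_0,\dots,x_n)=\varphi_n(x_0,\dots,x_n)\mathbf{1}_{V_n(x_n)\ge a}\prod_{1\le p<n}G_p^-(x_0,\dots,x_p)$. $P_n(a)=\mathbb{P}(V_n(X_n)\ge a)$ and $P_n(a,\varphi_n)=\mathbb{E}[\varphi_n(X_0,\dots,X_n)\mid V_n(X_n)\ge a]$. $P_n^N(a)=\eta_n^N(T_n^{(a)}(1))\prod_{1\le p<n}\eta_p^N(G_p)$. $P_n^N(a,\varphi_n)=\eta_n^N(T_n^{(a)}(\varphi_n))/\eta_n^N(T_n^{(a)}(1))$, with the convention $P_n^N(a,\varphi_n)=0$ when $\eta_n^N(T_n^{(a)}(1))=0$ (equivalently when $P_n^N(a)=0$). *)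

(* Defs.v *)
From HB Require Import structures.
From mathcomp Require Import all_boot all_order all_algebra.
From mathcomp Require Import all_classical all_reals all_analysis.
From mathcomp Require Import measurable_realfun.

Set Implicit Arguments.
Unset Strict Implicit.
Unset Printing Implicit Defensive.

Import Order.TTheory GRing.Theory Num.Theory.
Import numFieldNormedType.Exports.

Local Open Scope classical_set_scope.
Local Open Scope ring_scope.

Section append_kernel.
Context dX dE dE' (X : measurableType dX) (E : measurableType dE)
  (E' : measurableType dE') (R : realType).
Variables (l : X -> E) (ml : measurable_fun setT l) (k : R.-pker E ~> E').

(* In kpull and kappend the measurability proof is a dummy parameter
   that makes the measure and kernel instances inferable. *)
Definition kpull of measurable_fun setT l : X -> {measure set E' -> \bar R} :=
  fun x => k (l x).

Let measurable_kpull U : measurable U ->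
  measurable_fun setT ((kpull ml) ^~ U).
Proof. by move=> mU; exact: measurableT_comp (measurable_kernel k U mU) ml. Qed.

HB.instance Definition _ :=
  isKernel.Build _ _ X E' R (kpull ml) measurable_kpull.

Let kpull_prob x : kpull ml x setT = 1%E.
Proof. exact: prob_kernel. Qed.

HB.instance Definition _ :=
  Kernel_isProbability.Build _ _ X E' R (kpull ml) kpull_prob.

Definition append (x : X) : set (X * E') -> \bar R :=
  pushforward (k (l x)) (pair x).

Let append0 x : append x set0 = 0%E.
Proof. by rewrite /append /pushforward preimage_set0 measure0. Qed.

Let append_ge0 x A : (0 <= append x A)%E.
Proof. exact: measure_ge0. Qed.

Let append_sigma_additive x : semi_sigma_additive (append x).
Proof.
have mx : measurable_fun setT (pair x : E' -> X * E') by exact: pair1_measurable.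
exact: (@measure_semi_sigma_additive _ _ _
  (measure_function_pushforward__canonical__measure_function_Measure
     (k (l x)) mx)).
Qed.

HB.instance Definition _ x := isMeasure.Build _ _ _ (append x)
  (append0 x) (append_ge0 x) (@append_sigma_additive x).

Definition kappend of measurable_fun setT l :
    X -> {measure set (X * E') -> \bar R} := append.

Let measurable_kappend (U : set (X * E')) : measurable U ->
  measurable_fun setT (fun x => kappend ml x U).
Proof.
move=> mU.
apply: (eq_measurable_fun (fun x => kpull ml x (xsection U x))).
  by move=> x _; rewrite /kpull /kappend /= /append /pushforward xsectionE.
by apply: measurable_fun_xsection_finite_kernel; rewrite inE.
Qed.

HB.instance Definition _ :=
  isKernel.Build _ _ X (X * E')%type R (kappend ml) measurable_kappend.

Let kappend_prob x : kappend ml x setT = 1%E.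
Proof. by rewrite /kappend /= /append /pushforward preimage_setT prob_kernel. Qed.

HB.instance Definition _ :=
  Kernel_isProbability.Build _ _ X (X * E')%type R (kappend ml) kappend_prob.

End append_kernel.

Section path_space.
Context (d : nat -> measure_display) (E : forall n, measurableType (d n)).

Fixpoint pdisp (n : nat) : measure_display :=
  if n is m.+1 then measure_prod_display (pdisp m, d m.+1) else d 0%N.

(* paths n is the product of E 0, ..., E n, associated to the left, with the
   product sigma-algebra *)
Fixpoint paths (n : nat) : measurableType (pdisp n) :=
  if n is m.+1 then (paths m * E m.+1)%type : measurableType _ else E 0%N.

Definition plast (n : nat) : paths n -> E n :=
  if n is m.+1 then snd else id.

Lemma measurable_plast n : measurable_fun setT (@plast n).
Proof. by case: n => [|n]; [exact: measurable_id|exact: measurable_snd]. Qed.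

(* K n is the transition from E n to E n.+1, and M n the transition from
   paths n to paths n.+1 of the historical process *)
Definition ptrans (R : realType) (K : forall n, R.-pker E n ~> E n.+1)
    (n : nat) : R.-pker paths n ~> paths n.+1 :=
  kappend (K n) (@measurable_plast n).

Lemma ptransE (R : realType) (K : forall n, R.-pker E n ~> E n.+1) n
    (y : paths n) (A : set (paths n.+1)) :
  ptrans K n y A = K n (plast y) [set x | A (y, x)].
Proof. by []. Qed.

(* A function H of (x_0, ..., x_p) seen as a function of (x_0, ..., x_n) for
   p <= n (see plift_id and plift_succ); 0 by convention when n < p. *)
Fixpoint plift (R : realType) (p : nat) (H : paths p -> R) (n : nat) :
    paths n -> R :=
  if p =P n is ReflectT e then eq_rect p (fun k => paths k -> R) H n e else
  match n return paths n -> R with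
  | 0%N => fun=> 0
  | m.+1 => fun y => plift H y.1
  end.

Lemma plift_id (R : realType) p (H : paths p -> R) : plift H (n := p) = H.
Proof. by case: p H => [|p] H /=; case: eqP => // e; rewrite eq_axiomK. Qed.

Lemma plift_succ (R : realType) p (H : paths p -> R) n (y : paths n.+1) :
  (p <= n)%N -> plift H y = plift H y.1.
Proof.
move=> pn /=; case: eqP => // e; exfalso.
by move: pn; rewrite e ltnn.
Qed.

(* The path (X 0, ..., X n) *)
Fixpoint hist (T : Type) (X : forall n, T -> E n) (n : nat) : T -> paths n :=
  match n return T -> paths n with
  | 0%N => X 0%N
  | m.+1 => fun w => (hist X m w, X m.+1 w)
  end.

End path_space.

Section kernel_expectation.
Context (R : realType) (d : nat -> measure_display)
  (S : forall n, measurableType (d n)).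
Variable Q : forall n, R.-pker S n ~> S n.+1.

(* For p <= n, kexp f p x is the expectation of f at time n for the Markov
   chain with transitions Q started from x at time p, i.e., the composition
   Q p (... (Q n.-1 f)) x (see kexp_id and kexp_succ); 0 by convention when
   n < p. *)
Fixpoint kexp (n : nat) : (S n -> R) -> forall p, S p -> R :=
  fun f p =>
  if n =P p is ReflectT e then eq_rect n (fun k => S k -> R) f p e else
  match n return (S n -> R) -> S p -> R with
  | 0%N => fun _ _ => 0
  | m.+1 => fun f => kexp (fun y => \int[Q m y]_z f z) (p := p)
  end f.

Lemma kexp_id n (f : S n -> R) : kexp f (p := n) = f.
Proof. by case: n f => [|n] f /=; case: eqP => // e; rewrite eq_axiomK. Qed.

Lemma kexp_succ n (f : S n.+1 -> R) p : (p <= n)%N ->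
  kexp f (p := p) = kexp (fun y => \int[Q n y]_z f z) (p := p).
Proof.
move=> pn /=; case: eqP => // e; exfalso.
by move: pn; rewrite -e ltnn.
Qed.

End kernel_expectation.

Section empirical.
Context d (T : measurableType d) (R : realType) (N : nat) (x : 'I_N -> T).

Definition empirical (A : set T) : \bar R :=
  ((N%:R^-1)%:E * \sum_(i < N) \d_(x i) A)%E.

Let empirical0 : empirical set0 = 0%E.
Proof. by rewrite /empirical big1 ?mule0// => i _; rewrite measure0. Qed.

Let empirical_ge0 A : (0 <= empirical A)%E.
Proof. by rewrite mule_ge0// ?lee_fin ?invr_ge0//; exact: sume_ge0. Qed.

Let empirical_sigma_additive : semi_sigma_additive empirical.
Proof.
pose m (k : nat) : {measure set T -> \bar R} :=
  if insub k is Some i then \d_(x i) else mzero.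
have r0 : 0 <= (N%:R^-1 : R) by rewrite invr_ge0.
rewrite (_ : empirical = mscale (NngNum r0) (msum m N)).
  exact: measure_semi_sigma_additive.
apply/funext => A; rewrite /empirical /mscale /msum /=; congr (_ * _)%E.
by apply: eq_bigr => i _; rewrite /m valK.
Qed.

HB.instance Definition _ := isMeasure.Build _ _ _ empirical
  empirical0 empirical_ge0 empirical_sigma_additive.

End empirical.
Arguments empirical {d T R N} x.

Section chain.
Context (R : realType) (d : nat -> measure_display)
  (E : forall n, measurableType (d n)).
Variables (K : forall n, R.-pker E n ~> E n.+1) (x0 : E 0%N).
Context (dO : measure_display) (O : measurableType dO) (P : probability O R).
Variable X : forall n, O -> E n.

(* As C ranges over the measurable sets of paths, the events
   hist X n @^-1` C form the sigma-algebra generated by X 0, ..., X n. *)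
Definition markov_chain :=
  [/\ forall n, measurable_fun setT (X n),
      forall w, X 0%N w = x0
    & forall n (C : set (paths E n)) (A : set (E n.+1)),
        measurable C -> measurable A ->
        P (hist X n @^-1` C `&` X n.+1 @^-1` A) =
        (\int[P]_(w in hist X n @^-1` C) K n (X n w) A)%E].

Variable G : forall n, paths E n -> R.

Definition FKgamma (n : nat) (f : paths E n -> R) : R :=
  fine 'E_P[fun w => f (hist X n w) * \prod_(1 <= k < n) G (hist X k w)].

Definition FKeta (n : nat) (f : paths E n -> R) : R :=
  FKgamma f / FKgamma (fun=> 1 : R) (n := n).

(* Phi n maps a measure on paths n to (the values on sets of) a measure on
   paths n.+1. *)
Definition Phi (n : nat) (mu : {measure set (paths E n) -> \bar R})
    (A : set (paths E n.+1)) : R :=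
  (\int[mu]_y (G y * fine (ptrans K n y A))) / \int[mu]_y G y.

End chain.

Definition pot_inv (R : realType) d (E : forall n : nat, measurableType (d n))
    (G : forall n, paths E n -> R) : forall n, paths E n -> R :=
  fun n y => (G n y)^-1.

(* Only the times n >= 1 are constrained. *)
Definition potential (R : realType) d (E : forall n : nat, measurableType (d n))
    (G : forall n, paths E n -> R) :=
  forall n, (0 < n)%N ->
    [/\ measurable_fun setT (G n), forall y, 0 < G n y
      & exists c, forall y y', G n y / G n y' <= c].

Section particles.
Context (R : realType) (d : nat -> measure_display)
  (E : forall n, measurableType (d n)).
Variable K : forall n, R.-pker E n ~> E n.+1.
Context (dO : measure_display) (O : measurableType dO) (P : probability O R).
Variables (X : forall n, O -> E n) (G : forall n, paths E n -> R).
Context (dU : measure_display) (U : measurableType dU) (PU : probability U R).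
Variables (N : nat) (xi : forall n, 'I_N -> U -> paths E n).

(* The sigma-algebra generated by the particles at the times 1, ..., n *)
Definition past (n : nat) : set (set U) :=
  <<s [set C | exists k (i : 'I_N) (A : set (paths E k)),
        [/\ (0 < k <= n)%N, measurable A & C = xi k i @^-1` A] ] >>.

Definition particle_system :=
  [/\ forall n (i : 'I_N), (0 < n)%N -> measurable_fun setT (xi n i),
      forall A : 'I_N -> set (paths E 1), (forall i, measurable (A i)) ->
        PU (\bigcap_i (xi 1%N i @^-1` A i)) =
        (\prod_i FKeta P X G (\1_(A i)))%:E
    & forall n (A : 'I_N -> set (paths E n.+1)) (B : set U),
        (0 < n)%N -> (forall i, measurable (A i)) -> past n B ->
        PU (B `&` \bigcap_i (xi n.+1 i @^-1` A i)) =
        (\int[PU]_(w in B)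
           (\prod_i Phi K G (empirical (fun i => xi n i w)) (A i))%:E)%E].

End particles.

Section rare_event.
Context (R : realType) (d : nat -> measure_display)
  (E : forall n, measurableType (d n)).
Variable K : forall n, R.-pker E n ~> E n.+1.
Context (dO : measure_display) (O : measurableType dO) (P : probability O R).
Variables (X : forall n, O -> E n) (G : forall n, paths E n -> R).
Variables (n : nat) (V : E n -> R) (a : R).

Definition level_set : set (E n) := [set x | a <= V x].

Definition rare_prob : R := fine (P (X n @^-1` level_set)).

Definition rare_mean (phi : paths E n -> R) : R :=
  fine 'E_P[fun w => phi (hist X n w) * \1_level_set (X n w)] / rare_prob.

Definition rare_T (phi : paths E n -> R) (y : paths E n) : R :=
  phi y * \1_level_set (plast y) *
    \prod_(1 <= p < n) plift (pot_inv G (n := p)) y.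

Definition cond_prob (p : nat) (y : paths E p) : R :=
  kexp K (\1_level_set) (plast y).

Definition cond_mean (phi : paths E n -> R) (p : nat) (y : paths E p) : R :=
  kexp (ptrans K)
    (fun z => (phi z - rare_mean phi) * \1_level_set (plast z)) y.

Context (dU : measure_display) (U : measurableType dU).
Variables (N : nat) (xi : forall n, 'I_N -> U -> paths E n).

Definition rare_prob_est (w : U) : R :=
  \int[empirical (fun i => xi n i w)]_y rare_T (fun=> 1) y *
  \prod_(1 <= p < n) \int[empirical (fun i => xi p i w)]_y G y.

(* The quotient is 0 when its denominator is, since x / 0 = 0. *)
Definition rare_mean_est (phi : paths E n -> R) (w : U) : R :=
  \int[empirical (fun i => xi n i w)]_y rare_T phi y /
  \int[empirical (fun i => xi n i w)]_y rare_T (fun=> 1) y.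

End rare_event.

(* Main.v *)
Require Import Defs.
From HB Require Import structures.
From mathcomp Require Import all_boot all_order all_algebra.
From mathcomp Require Import all_classical all_reals all_analysis.
From mathcomp Require Import measurable_realfun.
From mathcomp Require Import lra ring.

Set Implicit Arguments.
Unset Strict Implicit.
Unset Printing Implicit Defensive.

Import Order.TTheory GRing.Theory Num.Theory.
Import numFieldNormedType.Exports.

Local Open Scope classical_set_scope.
Local Open Scope ring_scope.

(* Let m be the conditional mean, and let A, B be the particle estimators of
   gamma_n applied to T(phi - m) and T(1), and b = P_n(a). The estimation
   error on {B > 0} is D = A / B, it is bounded, and
     b^2 D = 2 b A - A B + D (B - b)^2.
   The particle estimators of gamma_n are unbiased, so E A = 0; conditioning
   on the previous generation gives an exact recursion for E[A B], which yields
   N E[A B] --> the sum over p; and the conditional independence of the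
   particles gives fourth moments of A and B - b of order N^-2 (through
   exponential moments), hence N E[D (B - b)^2] --> 0. *)

(** * Bounded measurable functions *)

(** The obstacle is that [B] has no positive lower bound, so [A / B] cannot be expanded around [b]
    under the expectation. The identity is b^2 = 2 b B - B^2 + (B - b)^2 multiplied by [D], with A =
    D B: the quotient survives only in the remainder. There, boundedness of [D] alone gives
    E[D (B - b)^2] = O(1/N), which is not enough; the missing factor N^(-1/2) comes from b D = A - D
    (B - b), which makes [D] itself small, at the price of moments above the second. Unbiasedness
    rests on [path_weight], the product of the inverse potentials: inserted in gamma_n it undoes the
    change of measure, so the estimators target plain expectations of the chain, and a step of the
    particle system acts on them as a step of the historical kernel. Conditional expectations are
    never formed: conditioning is expressed by integrals against bounded weights measurable with
    respect to the past. *)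

Section bounded_measurable.
Context (R : realType).

(** The bound holds everywhere rather than almost everywhere, so the class serves at once for the
    chain, the kernels and the particles. *)
Definition bmeas d (T : measurableType d) (f : T -> R) :=
  measurable_fun setT f /\ exists C, forall x, `|f x| <= C.

Context d (T : measurableType d).
Implicit Types f g : T -> R.

Lemma eq_bmeas f g : f =1 g -> bmeas f -> bmeas g.
Proof. by move=> /funext ->. Qed.

Lemma bmeas_cst (c : R) : bmeas (fun _ : T => c).
Proof. by split; [exact: measurable_cst|exists `|c|]. Qed.

Lemma bmeasD f g : bmeas f -> bmeas g -> bmeas (fun x => f x + g x).
Proof.
move=> [mf [C fC]] [mg [D gD]]; split; first exact: measurable_funD.
by exists (C + D) => x; rewrite (le_trans (ler_normD _ _))// lerD.
Qed.

Lemma bmeasM f g : bmeas f -> bmeas g -> bmeas (fun x => f x * g x).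
Proof.
move=> [mf [C fC]] [mg [D gD]]; split; first exact: measurable_funM.
by exists (C * D) => x; rewrite normrM ler_pM.
Qed.

Lemma bmeasZ f (c : R) : bmeas f -> bmeas (fun x => c * f x).
Proof. exact/bmeasM/bmeas_cst. Qed.

Lemma bmeasN f : bmeas f -> bmeas (fun x => - f x).
Proof.
move=> [mf [C fC]]; split; first exact: measurable_funN.
by exists C => x; rewrite normrN.
Qed.

Lemma bmeasB f g : bmeas f -> bmeas g -> bmeas (fun x => f x - g x).
Proof. by move=> bf /bmeasN; exact: bmeasD. Qed.

Lemma bmeasX f k : bmeas f -> bmeas (fun x => f x ^+ k).
Proof.
move=> bf; elim: k => [|k IH]; first exact: bmeas_cst.
by apply: eq_bmeas (bmeasM bf IH) => x; rewrite exprS.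
Qed.

Lemma bmeas_sum I (r : seq I) (Q : pred I) (F : I -> T -> R) :
  (forall i, Q i -> bmeas (F i)) -> bmeas (fun x => \sum_(i <- r | Q i) F i x).
Proof.
move=> bF; elim: r => [|i r IH].
  by apply: eq_bmeas (bmeas_cst _) => x; rewrite big_nil.
case Qi : (Q i); last by apply: eq_bmeas IH => x; rewrite big_cons Qi.
by apply: eq_bmeas (bmeasD (bF i Qi) IH) => x; rewrite big_cons Qi.
Qed.

Lemma bmeas_prod (I : eqType) (r : seq I) (Q : pred I) (F : I -> T -> R) :
  (forall i, i \in r -> Q i -> bmeas (F i)) ->
  bmeas (fun x => \prod_(i <- r | Q i) F i x).
Proof.
elim: r => [|i r IH] bF.
  by apply: eq_bmeas (bmeas_cst _) => x; rewrite big_nil.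
have {}IH : bmeas (fun x => \prod_(i <- r | Q i) F i x).
  by apply: IH => j jr; apply: bF; rewrite in_cons jr orbT.
case Qi : (Q i); last by apply: eq_bmeas IH => x; rewrite big_cons Qi.
have bFi : bmeas (F i) by apply: bF Qi; rewrite mem_head.
by apply: eq_bmeas (bmeasM bFi IH) => x; rewrite big_cons Qi.
Qed.

Lemma bmeas_indic (A : set T) : measurable A -> bmeas (\1_A : T -> R).
Proof.
move=> mA; split; first exact: measurable_indic.
by exists 1 => x; rewrite indicE; case: (_ \in _); rewrite ?normr1 ?normr0.
Qed.

Lemma bmeas_comp d' (T' : measurableType d') (h : T' -> T) f :
  measurable_fun setT h -> bmeas f -> bmeas (fun x => f (h x)).
Proof.
move=> mh [mf [C fC]]; split; last by exists C.
exact: measurableT_comp.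
Qed.

Lemma bmeas_expR f : bmeas f -> bmeas (fun x => expR (f x)).
Proof.
move=> [mf [C fC]]; split.
  by apply: measurableT_comp mf; exact: measurable_expR.
exists (expR C) => x; rewrite ger0_norm ?expR_ge0// ler_expR.
exact: le_trans (ler_norm _) (fC x).
Qed.

(** [f] may vanish: the inverse of 0 is 0, and so is [powR 0 (-1)]. This covers ratios of particle
    estimators with a denominator that may be 0. *)
Lemma measurable_inv_ge0 f : measurable_fun setT f -> (forall x, 0 <= f x) ->
  measurable_fun setT (fun x => (f x)^-1).
Proof.
move=> mf f0; rewrite (_ : (fun x => _) = @powR R ^~ (-1) \o f); last first.
  by apply/funext => x /=; rewrite powR_inv1.
by apply: measurableT_comp mf; exact: measurable_powR.
Qed.

Lemma bmeasV f (c : R) : 0 < c -> (forall x, c <= f x) -> bmeas f ->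
  bmeas (fun x => (f x)^-1).
Proof.
move=> c0 cf [mf _]; have f0 x : 0 < f x by exact: lt_le_trans (cf x).
split; first by apply: measurable_inv_ge0 => // x; exact: ltW.
exists c^-1 => x; rewrite ger0_norm; last by rewrite invr_ge0 ltW.
by rewrite lef_pV2 ?posrE.
Qed.

Lemma bmeas_boundP f : bmeas f -> exists2 C, 1 <= C & forall x, `|f x| <= C.
Proof.
move=> [_ [C fC]]; exists (Num.max 1 C); first by rewrite le_max lexx.
by move=> x; rewrite le_max fC orbT.
Qed.

(* The witness rounds [f] down to [- C + k * e], where [C] bounds [f]. *)
Lemma bmeas_approx f (e : R) : bmeas f -> 0 < e ->
  exists m (c : 'I_m -> R) (A : 'I_m -> set T),
    (forall k, measurable (A k)) /\
    forall x, `|f x - \sum_k c k * \1_(A k) x| <= e.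
Proof.
move=> bf e0; have [C C1 fC] := bmeas_boundP bf; have [mf _] := bf.
(* f + C lies in [0, 2 C], so no level index exceeds this [m]. *)
pose m := Num.trunc (2 * C / e).
pose A (k : nat) := f @^-1` `[- C + k%:R * e, - C + k.+1%:R * e[%classic.
exists m.+1, (fun k => - C + k%:R * e), (fun k => A k); split.
  by move=> k; rewrite -[X in measurable X]setTI; apply: mf.
move=> x; have := fC x; rewrite ler_norml => /andP[fl fu].
pose j := Num.trunc ((f x + C) / e).
have fC0 : 0 <= (f x + C) / e by apply: divr_ge0; lra.
have /andP[jl ju] := truncn_itv fC0.
rewrite -/j ler_pdivlMr// in jl; rewrite -/j ltr_pdivrMr// in ju.
have jm : (j < m.+1)%N.
  rewrite ltnS /m /j le_truncn// ler_pM2r ?invr_gt0//; lra.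
have jA : A j x by rewrite /A/= in_itv/=; apply/andP; split; lra.
have AE (k : nat) : A k x -> k = j.
  rewrite /A/= in_itv/= => /andP[kl ku].
  have {}kl : k%:R <= (f x + C) / e by rewrite ler_pdivlMr//; lra.
  have {}ku : (f x + C) / e < k.+1%:R by rewrite ltr_pdivrMr//; lra.
  apply/esym/truncn_def; by rewrite kl.
rewrite (bigD1 (Ordinal jm))//= big1 ?addr0; last first.
  move=> k kj; rewrite indicE memNset ?mulr0// => /AE kE.
  by move/eqP : kj; apply; exact/val_inj.
rewrite indicE mem_set// mulr1.
move: jA; rewrite /A/= in_itv/= -natr1 mulrDl mul1r => /andP[a b].
rewrite ger0_norm; lra.
Qed.

End bounded_measurable.

Section expectation_bmeas.
Context (R : realType) d (T : measurableType d) (mu : {measure set T -> \bar R}).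
(** A measure of mass one instead of a [probability], so that kernel values and empirical measures
    are covered directly. *)
Hypothesis mu1 : mu setT = 1%E.
Implicit Types f g : T -> R.

Lemma bmeas_integrable f : bmeas f -> mu.-integrable setT (EFin \o f).
Proof.
move=> [mf [C fC]]; apply: measurable_bounded_integrable => //.
  by rewrite mu1 ltey.
exists C; split; first exact: num_real.
by move=> M CM x _; exact: le_trans (fC x) (ltW CM).
Qed.

Lemma ExpD f g : bmeas f -> bmeas g ->
  \int[mu]_x (f x + g x) = \int[mu]_x f x + \int[mu]_x g x.
Proof. by move=> bf bg; rewrite RintegralD//; exact: bmeas_integrable. Qed.

Lemma ExpB f g : bmeas f -> bmeas g ->
  \int[mu]_x (f x - g x) = \int[mu]_x f x - \int[mu]_x g x.
Proof. by move=> bf bg; rewrite RintegralB//; exact: bmeas_integrable. Qed.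

Lemma ExpZ (c : R) f : bmeas f -> \int[mu]_x (c * f x) = c * \int[mu]_x f x.
Proof. by move=> bf; rewrite RintegralZl//; exact: bmeas_integrable. Qed.

Lemma Exp_cst (c : R) : \int[mu]_x c = c.
Proof. by rewrite Rintegral_cst// mu1 mulr1. Qed.

Lemma le_Exp f g : bmeas f -> bmeas g -> (forall x, f x <= g x) ->
  \int[mu]_x f x <= \int[mu]_x g x.
Proof. by move=> bf bg fg; apply: le_Rintegral => //; exact: bmeas_integrable. Qed.

Lemma Exp_norm_le (c : R) f : bmeas f -> (forall x, `|f x| <= c) ->
  `|\int[mu]_x f x| <= c.
Proof.
move=> bf fc; rewrite ler_norml; apply/andP; split.
  rewrite -[leLHS]Exp_cst; apply: le_Exp => //; first exact: bmeas_cst.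
  by move=> x; have := fc x; rewrite ler_norml => /andP[].
rewrite -[leRHS]Exp_cst; apply: le_Exp => //; first exact: bmeas_cst.
by move=> x; have := fc x; rewrite ler_norml => /andP[].
Qed.

Lemma Exp_sum I (r : seq I) (F : I -> T -> R) :
  (forall i, bmeas (F i)) ->
  \int[mu]_x (\sum_(i <- r) F i x) = \sum_(i <- r) \int[mu]_x F i x.
Proof.
move=> bF; elim: r => [|i r IH].
  by rewrite big_nil; under eq_Rintegral do rewrite big_nil; rewrite Exp_cst.
rewrite big_cons; under eq_Rintegral do rewrite big_cons.
by rewrite ExpD// ?IH//; exact: bmeas_sum.
Qed.

Lemma Exp_indic (A : set T) : measurable A ->
  \int[mu]_x (\1_A x : R) = fine (mu A).
Proof. by move=> mA; rewrite /Rintegral integral_indic// setIT. Qed.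

End expectation_bmeas.

(** * Extension of identities from indicators to bounded functions *)

(** Uniform approximation by combinations of indicators reduces the claim to sets; both functionals
    are bounded in sup norm, so the error is at most C + C' times the tolerance. No convergence
    theorem is involved, which leaves room for signed weights. *)
Lemma eq_bmeas_functional (R : realType) d (T : measurableType d)
    (L L' : (T -> R) -> R) (C C' : R) :
  (forall f g, bmeas f -> bmeas g -> L (fun x => f x + g x) = L f + L g) ->
  (forall (c : R) f, bmeas f -> L (fun x => c * f x) = c * L f) ->
  (forall (c : R) f, bmeas f -> (forall x, `|f x| <= c) -> `|L f| <= C * c) ->
  (forall f g, bmeas f -> bmeas g -> L' (fun x => f x + g x) = L' f + L' g) ->
  (forall (c : R) f, bmeas f -> L' (fun x => c * f x) = c * L' f) ->
  (forall (c : R) f, bmeas f -> (forall x, `|f x| <= c) -> `|L' f| <= C' * c) ->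
  (forall A, measurable A -> L \1_A = L' \1_A) ->
  forall f, bmeas f -> L f = L' f.
Proof.
move=> LD LZ LC L'D L'Z L'C LL' f bf.
have C0 : 0 <= C.
  have := LC 1 (cst 0) (bmeas_cst T 0).
  by rewrite mulr1 => /(_ _)/(le_trans (normr_ge0 _)); apply=> x; rewrite normr0.
have C0' : 0 <= C'.
  have := L'C 1 (cst 0) (bmeas_cst T 0).
  by rewrite mulr1 => /(_ _)/(le_trans (normr_ge0 _)); apply=> x; rewrite normr0.
apply/eqP; rewrite -subr_eq0 -normr_le0; apply/ler_addgt0Pl => e e0.
rewrite addr0.
have D0 : 0 < C + C' + 1 by lra.
have [m [c [A [mA fA]]]] := bmeas_approx bf (divr_gt0 e0 D0).
pose s x := \sum_k c k * \1_(A k) x.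
have {}fA x : `|f x - s x| <= e / (C + C' + 1) by exact: fA.
have bA k : bmeas (fun x => c k * \1_(A k) x) by exact/bmeasZ/bmeas_indic.
have bs : bmeas s by apply: bmeas_sum => k _; exact: bA.
have Ls : L s = L' s.
  rewrite /s; elim: (index_enum _) => [|k r IH].
    (* L 0 = 0 is read off homogeneity, hence the empty sum is presented as 0 times a function. *)
    have -> : (fun x => \sum_(k <- [::]) c k * \1_(A k) x) =
              (fun x : T => 0 * (cst 0 x)) :> (T -> R).
      by apply/funext => x; rewrite big_nil mul0r.
    by rewrite LZ ?L'Z ?mul0r//; exact: bmeas_cst.
  have -> : (fun x => \sum_(k <- k :: r) c k * \1_(A k) x) =
      (fun x : T => c k * \1_(A k) x + \sum_(k <- r) c k * \1_(A k) x) :> (T -> R).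
    by apply/funext => x; rewrite big_cons.
  rewrite LD ?L'D//; [|by apply: bmeas_sum => i _; exact: bA..].
  by rewrite IH LZ ?L'Z ?LL'//; exact: bmeas_indic.
have bfs : bmeas (fun x => f x - s x) by exact: bmeasB.
have fE : f = (fun x => (f x - s x) + s x).
  by apply/funext => x; rewrite subrK.
have -> : L f = L (fun x => f x - s x) + L s by rewrite {1}fE; exact: LD.
have -> : L' f = L' (fun x => f x - s x) + L' s by rewrite {1}fE; exact: L'D.
rewrite Ls opprD addrACA subrr addr0.
rewrite (le_trans (ler_normB _ _))//.
rewrite (le_trans (lerD (LC _ _ bfs fA) (L'C _ _ bfs fA)))//.
rewrite -mulrDl mulrCA; apply: ler_piMr; first exact: ltW.
by rewrite ler_pdivrMr//; lra.
Qed.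

(** * Elementary bounds on the exponential *)

(** From expR (- x) >= 1 - x one gets (1 - x) expR x <= 1, and (1 - x)(1 + x + 2 x^2) = 1 + x^2 (1 -
    2 x) is at least 1 for x <= 1/2. *)
Lemma expR_le_quadratic (R : realType) (x : R) :
  x <= 2^-1 -> expR x <= 1 + x + 2 * x ^+ 2.
Proof.
move=> x2; have := expR_ge1Dx (- x) => h.
have e0 := expR_gt0 x; have e1 := expRxMexpNx_1 x; nra.
Qed.

Lemma expr4_le_expR (R : realType) (x : R) : x ^+ 4 <= 24 * (expR x + expR (- x)).
Proof.
have h (y : R) : 0 <= y -> y ^+ 4 <= 24 * expR y.
  move=> y0; have := expR_ge1Dxn 3 y0; rewrite (_ : 4`!%N = 24%N)// => h.
  have : y ^+ 4 / 24 <= expR y by apply: le_trans h; rewrite lerDr.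
  by rewrite ler_pdivrMr// mulrC.
have [x0|x0] := leP 0 x.
  by rewrite (le_trans (h _ x0))// ler_pM2l// lerDl expR_ge0.
have -> : x ^+ 4 = (- x) ^+ 4 by ring.
have nx0 : 0 <= - x by rewrite oppr_ge0 ltW.
by rewrite (le_trans (h _ nx0))// ler_pM2l// lerDr expR_ge0.
Qed.

(** * Integration against a random probability measure *)

Section averaging.
Context (R : realType) dS dT (S : measurableType dS) (T : measurableType dT).

(* [Lam f w] is the integral of [f] with respect to a probability measure
   depending on [w]. *)
Definition averaging (Lam : (T -> R) -> S -> R) :=
  [/\ forall f, bmeas f -> measurable_fun setT (Lam f),
      forall f g w, bmeas f -> bmeas g ->
        Lam (fun x => f x + g x) w = Lam f w + Lam g w,
      forall (c : R) f w, bmeas f -> Lam (fun x => c * f x) w = c * Lam f w,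
      forall f g w, bmeas f -> bmeas g -> (forall x, f x <= g x) ->
        Lam f w <= Lam g w
    & forall w, Lam (fun=> 1) w = 1].

Context (Lam : (T -> R) -> S -> R) (aL : averaging Lam).

Lemma averaging_cst (c : R) w : Lam (fun=> c) w = c.
Proof.
have [_ _ LZ _ L1] := aL.
have -> : (fun=> c) = (fun x : T => c * (fun=> 1) x) by apply/funext=> x; rewrite mulr1.
by rewrite LZ ?L1 ?mulr1//; exact: bmeas_cst.
Qed.

Lemma averaging_norm_le f (c : R) w : bmeas f -> (forall x, `|f x| <= c) ->
  `|Lam f w| <= c.
Proof.
have [_ _ LZ Lle L1] := aL => bf fc; rewrite ler_norml; apply/andP; split.
  rewrite -[leLHS](averaging_cst _ w); apply: Lle => //; first exact: bmeas_cst.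
  by move=> x; have := fc x; rewrite ler_norml => /andP[].
rewrite -[leRHS](averaging_cst _ w); apply: Lle => //; first exact: bmeas_cst.
by move=> x; have := fc x; rewrite ler_norml => /andP[].
Qed.

Lemma averaging_bmeas f : bmeas f -> bmeas (Lam f).
Proof.
move=> bf; have [mL _ _ _ _] := aL; split; first exact: mL.
by have [_ [C fC]] := bf; exists C => w; exact: averaging_norm_le.
Qed.

End averaging.

(** The weights may differ and change sign: each side is still linear in f and bounded in sup norm
    by the bound on its weight. Factors not being replaced at a given stage are stored in the
    weights. *)
Lemma eq_weighted_averaging (R : realType) dS dT (S : measurableType dS)
    (T : measurableType dT) (mu : {measure set S -> \bar R})
    (W W' : S -> R) (F F' : (T -> R) -> S -> R) :
  mu setT = 1%E -> bmeas W -> bmeas W' -> averaging F -> averaging F' ->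
  (forall A, measurable A ->
    \int[mu]_w (W w * F \1_A w) = \int[mu]_w (W' w * F' \1_A w)) ->
  forall f, bmeas f -> \int[mu]_w (W w * F f w) = \int[mu]_w (W' w * F' f w).
Proof.
move=> mu1 bW bW' aF aF' FF' f bf.
have func (V : S -> R) (H : (T -> R) -> S -> R) : bmeas V -> averaging H ->
    [/\ forall f g, bmeas f -> bmeas g ->
        \int[mu]_w (V w * H (fun x => f x + g x) w) =
        \int[mu]_w (V w * H f w) + \int[mu]_w (V w * H g w),
      forall (c : R) f, bmeas f ->
        \int[mu]_w (V w * H (fun x => c * f x) w) = c * \int[mu]_w (V w * H f w)
    & exists C, forall (c : R) f, bmeas f -> (forall x, `|f x| <= c) ->
        `|\int[mu]_w (V w * H f w)| <= C * c].
  move=> bV aH; have [_ HD HZ _ _] := aH.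
  have bVH g : bmeas g -> bmeas (fun w => V w * H g w).
    by move=> bg; apply: bmeasM => //; exact: averaging_bmeas.
  split.
  - move=> g h bg bh; rewrite -ExpD//; try exact: bVH.
    by apply: eq_Rintegral => w _; rewrite HD// mulrDr.
  - move=> c g bg; rewrite -ExpZ//; last exact: bVH.
    by apply: eq_Rintegral => w _; rewrite HZ// mulrCA.
  - have [_ [C VC]] := bV; exists C => c g bg gc.
    apply: Exp_norm_le => //; first exact: bVH.
    by move=> w; rewrite normrM ler_pM//; exact: averaging_norm_le.
have [WD WZ [C WC]] := func _ _ bW aF.
have [W'D W'Z [C' W'C]] := func _ _ bW' aF'.
exact: (eq_bmeas_functional WD WZ WC W'D W'Z W'C).
Qed.

(** * Conditionally i.i.d. samples *)

Section conditionally_iid.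
Context (R : realType) dU (U : measurableType dU) (PU : probability U R).
Context dT (T : measurableType dT) (N : nat) (zeta : 'I_N -> U -> T).
Context (gens : set (set U)) (Lam : (T -> R) -> U -> R).
Hypothesis mgens : gens `<=` measurable.
Hypothesis mzeta : forall i, measurable_fun setT (zeta i).
(** The points of [U] with the sigma-algebra generated by [gens]: the ascription [H : past -> R] is
    what expresses measurability with respect to the past. *)
Let past : measurableType _ := g_sigma_algebraType gens.
Hypothesis aLam : averaging (Lam : (T -> R) -> past -> R).
Hypothesis law : forall (A : 'I_N -> set T) (B : set U),
  (forall i, measurable (A i)) -> <<s gens >> B ->
  PU (B `&` \bigcap_i (zeta i @^-1` A i)) =
  (\int[PU]_(w in B) (\prod_i Lam \1_(A i) w)%:E)%E.

Lemma past_measurable_set (B : set U) : <<s gens >> B -> measurable B.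
Proof.
by move=> sB; apply: sB; split => //; exact: sigma_algebra_measurable.
Qed.

Lemma past_bmeas (H : past -> R) : bmeas H -> bmeas (H : U -> R).
Proof.
move=> [mH bH]; split => // _ B mB; rewrite setTI; apply: past_measurable_set.
by have := mH measurableT B mB; rewrite setTI.
Qed.

Lemma averaging_past : averaging (Lam : (T -> R) -> U -> R).
Proof.
have [_ LD LZ Lle L1] := aLam; split => // f bf.
by have [] := past_bmeas (averaging_bmeas aLam bf).
Qed.

(** The Dirac case: a sample and its conditional law fall under the same notion, so
    [eq_weighted_averaging] can exchange one for the other. *)
Lemma averaging_comp d' (S : measurableType d') (z : S -> T) :
  measurable_fun setT z -> averaging (fun (f : T -> R) w => f (z w)).
Proof.
move=> mz; split => // f [mf _]; exact: measurableT_comp.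
Qed.

Lemma prod_indic (I : finType) (A : I -> set T) (z : I -> T) :
  \prod_i (\1_(A i) (z i) : R) = \1_(\bigcap_i (fun u : I -> T => u i) @^-1` A i) z.
Proof.
rewrite indicE; case: (boolP (z \in _)) => [|/negP] zA.
  rewrite big1// => i _; rewrite indicE mem_set//.
  by move: zA; rewrite inE; apply.
have [i zi] : exists i, ~ A i (z i).
  apply/existsNP => h; apply: zA; rewrite inE => i _; exact: h.
by rewrite (bigD1 i)//= indicE memNset// mul0r.
Qed.

Let law_indic (A : 'I_N -> set T) (B : set U) :
  (forall i, measurable (A i)) -> <<s gens >> B ->
  \int[PU]_w (\1_B w * \prod_i \1_(A i) (zeta i w)) =
  \int[PU]_w (\1_B w * \prod_i Lam \1_(A i) w).
Proof.
move=> mA sB; have mB := past_measurable_set sB.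
have mI : measurable (\bigcap_i (zeta i @^-1` A i)).
  apply: fin_bigcap_measurable => [|i _]; first exact: finite_finset.
  rewrite -[X in measurable X]setTI.
  exact: mzeta.
transitivity (fine (PU (B `&` \bigcap_i (zeta i @^-1` A i)))).
  rewrite -Exp_indic//; last exact: measurableI.
  apply: eq_Rintegral => w _; rewrite indicI/=; congr (_ * _).
  by rewrite prod_indic !indicE.
rewrite law// -[LHS]/(\int[PU]_(w in B) \prod_i Lam \1_(A i) w).
rewrite Rintegral_mkcond; apply: eq_Rintegral => w _.
by rewrite patchE indicE; case: (w \in B); rewrite ?mul1r ?mul0r.
Qed.

(* The indicators are replaced by bounded functions one coordinate at a time,
   and then in the factor [H] that depends on the past. *)
Lemma Exp_cond_prod (H : past -> R) (h : 'I_N -> T -> R) :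
  bmeas H -> (forall i, bmeas (h i)) ->
  \int[PU]_w (H w * \prod_i h i (zeta i w)) =
  \int[PU]_w (H w * \prod_i Lam (h i) w).
Proof.
move=> bH bh; have aL := averaging_past.
have az i := averaging_comp (mzeta i).
(* [k] counts the coordinates already allowed to be arbitrary: from index [k] on, [g i] is still an
   indicator. *)
have step k (B : set U) (g : 'I_N -> T -> R) : <<s gens >> B ->
    (forall i, bmeas (g i)) ->
    (forall i : 'I_N, (k <= i)%N -> exists A, measurable A /\ g i = \1_A) ->
    \int[PU]_w (\1_B w * \prod_i g i (zeta i w)) =
    \int[PU]_w (\1_B w * \prod_i Lam (g i) w).
  move=> sB; elim: k g => [|k IH] g bg gA.
    have [A AE] := choice (fun i => gA i (leq0n i)).
    have -> : g = fun i => \1_(A i) by apply/funext => i; case: (AE i).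
    by apply: law_indic => // i; case: (AE i).
  have [kN|Nk] := ltnP k N; last first.
    apply: IH => // i ki; exfalso.
    by have := leq_ltn_trans ki (ltn_ord i); rewrite ltnNge Nk.
  pose i0 := Ordinal kN.
  pose W w := \1_B w * \prod_(i | i != i0) g i (zeta i w).
  pose W' w := \1_B w * \prod_(i | i != i0) Lam (g i) w.
  have bB : bmeas (\1_B : U -> R) by exact/bmeas_indic/past_measurable_set.
  have bW : bmeas W.
    apply: bmeasM => //; apply: bmeas_prod => i _ _.
    exact: (averaging_bmeas (az i)).
  have bW' : bmeas W'.
    apply: bmeasM => //; apply: bmeas_prod => i _ _.
    exact: (averaging_bmeas aL).
  transitivity (\int[PU]_w (W w * g i0 (zeta i0 w))).
    by apply: eq_Rintegral => w _; rewrite (bigD1 i0)//= /W mulrAC mulrA.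
  transitivity (\int[PU]_w (W' w * Lam (g i0) w)); last first.
    by apply: eq_Rintegral => w _; rewrite [in RHS](bigD1 i0)//= /W' mulrAC mulrA.
  apply: (eq_weighted_averaging (probability_setT PU) bW bW' (az i0) aL _ (bg i0)).
  (* [g'] puts an indicator at coordinate [k], which brings it within reach of the induction
     hypothesis. *)
  move=> A mA; pose g' i := if i == i0 then \1_A : T -> R else g i.
  have g'i0 : g' i0 = \1_A by rewrite /g' eqxx.
  have g'E i : i != i0 -> g' i = g i by rewrite /g' => /negbTE ->.
  transitivity (\int[PU]_w (\1_B w * \prod_i g' i (zeta i w))).
    apply: eq_Rintegral => w _; rewrite [in RHS](bigD1 i0)//= g'i0 /W mulrAC mulrA.
    by congr (_ * _); apply: eq_bigr => i /g'E ->.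
  rewrite IH.
  - apply: eq_Rintegral => w _; rewrite [in LHS](bigD1 i0)//= g'i0 /W' mulrAC mulrA.
    by congr (_ * _); apply: eq_bigr => i /g'E ->.
  - by move=> i; rewrite /g'; case: ifP => // _; exact: bmeas_indic.
  - move=> i ki; have [->|ii0] := eqVneq i i0; first by exists A.
    rewrite g'E//; apply: gA; rewrite ltn_neqAle ki andbT.
    by apply: contra ii0 => /eqP kE; apply/eqP/val_inj.
pose W w := \prod_i h i (zeta i w).
pose W' w := \prod_i Lam (h i) w.
have bW : bmeas W.
  by apply: bmeas_prod => i _ _; exact: (averaging_bmeas (az i)).
have bW' : bmeas W' by apply: bmeas_prod => i _ _; exact: (averaging_bmeas aL).
transitivity (\int[PU]_w (W w * H w)).
  by apply: eq_Rintegral => w _; rewrite mulrC.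
transitivity (\int[PU]_w (W' w * H w)); last first.
  by apply: eq_Rintegral => w _; rewrite mulrC.
(* Evaluation of functions on [past] is averaging, so the same exchange lemma passes from past
   events to [H]; this time the operators agree and the weights differ. *)
have aid : averaging (fun (f : past -> R) (w : U) => f w).
  by split => // f bf; have [] := past_bmeas bf.
apply: (eq_weighted_averaging (probability_setT PU) bW bW' aid aid _ bH).
move=> B mB.
transitivity (\int[PU]_w (\1_B w * W w)).
  by apply: eq_Rintegral => w _; rewrite mulrC.
rewrite (step N)//; last first.
  by move=> i Ni; have := ltn_ord i; rewrite ltnNge Ni.
by apply: eq_Rintegral => w _; rewrite mulrC.
Qed.

Hypothesis N0 : (0 < N)%N.

Let PU1 : PU setT = 1%E := probability_setT PU.

Definition emp_mean (f : T -> R) (w : U) : R := N%:R^-1 * \sum_i f (zeta i w).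

Lemma emp_mean_bmeas f : bmeas f -> bmeas (emp_mean f).
Proof.
by move=> bf; apply/bmeasZ/bmeas_sum => i _; exact: bmeas_comp.
Qed.

Lemma emp_mean_norm_le f c w : (forall x, `|f x| <= c) -> `|emp_mean f w| <= c.
Proof.
move=> fc; have Nr0 : 0 < N%:R :> R by rewrite ltr0n.
rewrite /emp_mean normrM ger0_norm ?invr_ge0 ?ler0n// mulrC ler_pdivrMr//.
rewrite (le_trans (ler_norm_sum _ _ _))// (le_trans (ler_sum _ (fun i _ => fc _)))//.
by rewrite sumr_const card_ord mulr_natr.
Qed.

Let bmeas_zeta (f : T -> R) i : bmeas f -> bmeas (fun w : U => f (zeta i w)).
Proof. exact: bmeas_comp. Qed.

(** The other coordinates receive the constant 1, on which [Lam] is 1. The abstract [F] in [prodh]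
    stands for evaluation at the samples and then for [Lam]. *)
Let Exp_one (H : past -> R) f i : bmeas H -> bmeas f ->
  \int[PU]_w (H w * f (zeta i w)) = \int[PU]_w (H w * Lam f w).
Proof.
move=> bH bf; have [_ _ _ _ L1] := aLam.
pose h j := if j == i then f else cst 1.
have prodh (F : 'I_N -> (T -> R) -> R) :
    (forall j, F j (cst 1) = 1) -> \prod_j F j (h j) = F i f.
  move=> F1; rewrite (bigD1 i)//= {1}/h eqxx big1 ?mulr1// => j /negbTE.
  by rewrite /h => ->.
have bh j : bmeas (h j) by rewrite /h; case: ifP => // _; exact: bmeas_cst.
transitivity (\int[PU]_w (H w * \prod_j h j (zeta j w))).
  apply: eq_Rintegral => w _; congr (_ * _).
  by rewrite (prodh (fun j g => g (zeta j w))).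
rewrite (Exp_cond_prod bH bh); apply: eq_Rintegral => w _; congr (_ * _).
by rewrite (prodh (fun j g => Lam g w)).
Qed.

Let Exp_two (H : past -> R) f g i j : i != j -> bmeas H -> bmeas f -> bmeas g ->
  \int[PU]_w (H w * (f (zeta i w) * g (zeta j w))) =
  \int[PU]_w (H w * (Lam f w * Lam g w)).
Proof.
move=> ij bH bf bg; have [_ _ _ _ L1] := aLam.
pose h k := if k == i then f else if k == j then g else cst 1.
have prodh (F : 'I_N -> (T -> R) -> R) :
    (forall j, F j (cst 1) = 1) -> \prod_j F j (h j) = F i f * F j g.
  move=> F1; rewrite (bigD1 i)//= {1}/h eqxx; congr (_ * _).
  rewrite (bigD1 j)/=; last by rewrite eq_sym.
  rewrite {1}/h [j == i]eq_sym (negbTE ij) eqxx big1 ?mulr1// => k.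
  by rewrite /h => /andP[/negbTE -> /negbTE ->].
have bh k : bmeas (h k).
  by rewrite /h; case: ifP => // _; case: ifP => // _; exact: bmeas_cst.
transitivity (\int[PU]_w (H w * \prod_j h j (zeta j w))).
  apply: eq_Rintegral => w _; congr (_ * _).
  by rewrite (prodh (fun j g => g (zeta j w))).
rewrite (Exp_cond_prod bH bh); apply: eq_Rintegral => w _; congr (_ * _).
by rewrite (prodh (fun j g => Lam g w)).
Qed.

Lemma Exp_emp_mean (H : past -> R) f : bmeas H -> bmeas f ->
  \int[PU]_w (H w * emp_mean f w) = \int[PU]_w (H w * Lam f w).
Proof.
move=> bH bf; have bHU := past_bmeas bH.
have Nr0 : N%:R != 0 :> R by rewrite pnatr_eq0 -lt0n.
transitivity (\int[PU]_w (N%:R^-1 * \sum_i H w * f (zeta i w))).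
  by apply: eq_Rintegral => w _; rewrite -mulr_sumr /emp_mean mulrCA.
have bi i : bmeas (fun w : U => H w * f (zeta i w)).
  by apply: bmeasM => //; exact: bmeas_comp.
rewrite ExpZ ?Exp_sum//; last by apply: bmeas_sum => i _.
under eq_bigr do rewrite Exp_one//.
by rewrite sumr_const card_ord -[X in _ * X]mulr_natl mulKf.
Qed.

(** Of the N^2 pairs of samples, the N diagonal ones contribute Lam (f g) and the N (N - 1) others,
    conditionally independent, contribute Lam f * Lam g. *)
Lemma Exp_emp_meanM (H : past -> R) f g : bmeas H -> bmeas f -> bmeas g ->
  \int[PU]_w (H w * (emp_mean f w * emp_mean g w)) =
  (1 - N%:R^-1) * \int[PU]_w (H w * (Lam f w * Lam g w)) +
  N%:R^-1 * \int[PU]_w (H w * Lam (fun x => f x * g x) w).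
Proof.
move=> bH bf bg; have bHU := past_bmeas bH.
have Nr0 : N%:R != 0 :> R by rewrite pnatr_eq0 -lt0n.
have bij i j : bmeas (fun w : U => H w * (f (zeta i w) * g (zeta j w))).
  by apply: (bmeasM bHU); apply: bmeasM; exact: bmeas_zeta.
transitivity (\int[PU]_w (N%:R^-2 *
    \sum_i \sum_j H w * (f (zeta i w) * g (zeta j w)))).
  apply: eq_Rintegral => w _; rewrite /emp_mean.
  have -> (x y z : R) : x * (N%:R^-1 * y * (N%:R^-1 * z)) =
    N%:R^-2 * (x * (y * z)) by field.
  congr (_ * _).
  rewrite mulr_suml mulr_sumr; apply: eq_bigr => i _.
  by rewrite mulr_sumr mulr_sumr.
rewrite ExpZ//; last by do 2 (apply: bmeas_sum => ? _).
rewrite Exp_sum//; last by move=> i; apply: bmeas_sum.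
set A := \int[PU]_w (H w * (Lam f w * Lam g w)).
set B := \int[PU]_w (H w * Lam (fun x => f x * g x) w).
transitivity (N%:R^-2 * \sum_(i < N) (B + (N%:R - 1) * A)).
  congr (_ * _); apply: eq_bigr => i _; rewrite Exp_sum// (bigD1 i)//=.
  congr (_ + _).
    by rewrite (Exp_one (f := fun x => f x * g x) i bH (bmeasM bf bg)).
  rewrite (eq_bigr (fun=> A)); last by move=> j ji; rewrite Exp_two// eq_sym.
  rewrite sumr_const cardC1 card_ord -[LHS]mulr_natl -[in LHS](prednK N0)/=.
  by rewrite -[in RHS](prednK N0) -natr1 addrK.
rewrite sumr_const card_ord -[X in _ * X]mulr_natl.
by field.
Qed.

(* With [X] the sum of the centred [f (zeta i)] and [t = 1 / (4 c sqrt N)], the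
   exponential moments of [t X] and [- t X] are at most [e]. *)
Lemma Exp_emp_mean_sub4 f c : 1 <= c -> bmeas f -> (forall x, `|f x| <= c) ->
  \int[PU]_w (emp_mean f w - Lam f w) ^+ 4 <=
  (12288 * expR 1) * c ^+ 4 / N%:R ^+ 2.
Proof.
move=> c1 bf fc; have [_ LD LZ Lle L1] := aLam; have aL := averaging_past.
have Nr0 : 0 < N%:R :> R by rewrite ltr0n.
have bLf : bmeas (Lam f : past -> R) by exact: averaging_bmeas.
have bLfU : bmeas (Lam f) by exact: past_bmeas.
pose X w := \sum_i f (zeta i w) - N%:R * Lam f w.
have bX : bmeas X.
  by apply: bmeasB; [apply: bmeas_sum => i _; exact: bmeas_comp|exact: bmeasZ].
(* [H] carries the centring exp(- s N Lam f), which depends on the past only. After conditioning,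
   the integrand is the N-th power of Lam (exp(s (f - Lam f))), itself at most 1 + 8 s^2 c^2 <=
   exp(8 s^2 c^2). *)
have expX (s : R) : `|s * (2 * c)| <= 2^-1 -> s ^+ 2 * (8 * c ^+ 2) * N%:R <= 1 ->
    \int[PU]_w expR (s * X w) <= expR 1.
  move=> sc sN; pose H w := expR (- (s * N%:R * Lam f w)).
  pose h (i : 'I_N) x := expR (s * f x).
  have bH : bmeas (H : past -> R) by exact/bmeas_expR/bmeasN/bmeasZ.
  have bh i : bmeas (h i) by exact/bmeas_expR/bmeasZ.
  have -> : \int[PU]_w expR (s * X w) =
      \int[PU]_w (H w * \prod_i h i (zeta i w)).
    apply: eq_Rintegral => w _; rewrite /H /h /X -expR_sum -expRD.
    by congr expR; rewrite -mulr_sumr; ring.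
  rewrite (Exp_cond_prod bH bh) -[leRHS](Exp_cst PU1); apply: le_Exp => //.
  - apply: bmeasM; first exact: past_bmeas.
    by apply: bmeas_prod => i _ _; exact: averaging_bmeas.
  - exact: bmeas_cst.
  move=> w; set l := Lam f w.
  have lc : `|l| <= c by exact: (averaging_norm_le aL).
  have -> : H w * \prod_i Lam (h i) w =
      Lam (fun x => expR (s * f x - s * l)) w ^+ N.
    rewrite (eq_bigr (fun=> Lam (fun x => expR (s * f x)) w))//.
    rewrite prodr_const card_ord /H -/l.
    rewrite (_ : - (s * N%:R * l) = - (s * l) * N%:R); last by ring.
    rewrite expRM_natr -exprMn -LZ; last exact/bmeas_expR/bmeasZ.
    by congr (Lam _ w ^+ _); apply/funext => x; rewrite -expRD addrC.
  have bq : bmeas (fun x => (1 + 8 * s ^+ 2 * c ^+ 2 - s * l) + s * f x).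
    by apply: bmeasD; [exact: bmeas_cst|exact: bmeasZ].
  have Lq : Lam (fun x => expR (s * f x - s * l)) w <= 1 + 8 * s ^+ 2 * c ^+ 2.
    (* The centred linear term averages to 0, so this constant is the mean of an affine function,
       which dominates the exponential pointwise by the quadratic bound. *)
    have -> : 1 + 8 * s ^+ 2 * c ^+ 2 =
        Lam (fun x => (1 + 8 * s ^+ 2 * c ^+ 2 - s * l) + s * f x) w.
      rewrite LD ?LZ//; [|exact: bmeas_cst|exact: bmeasZ].
      by rewrite (averaging_cst aL) -/l; ring.
    apply: Lle => //.
      by apply/bmeas_expR/bmeasD; [exact: bmeasZ|exact: bmeas_cst].
    move=> x; have fl : `|f x - l| <= 2 * c.
      by rewrite (le_trans (ler_normB _ _))// mulr2n mulrDl mul1r lerD.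
    have sfl : `|s * (f x - l)| <= 2^-1.
      rewrite (le_trans _ sc)// normrM [leRHS]normrM ler_wpM2l//.
      by rewrite (le_trans fl)// ler_norm.
    rewrite -mulrBr (le_trans (expR_le_quadratic _))//.
      by rewrite (le_trans (ler_norm _)).
    have : (s * (f x - l)) ^+ 2 <= s ^+ 2 * (2 * c) ^+ 2.
      rewrite exprMn ler_wpM2l ?sqr_ge0// -[leLHS]real_normK ?num_real//.
      by rewrite ler_sqr ?nnegrE//; lra.
    lra.
  have L0 : 0 <= Lam (fun x => expR (s * f x - s * l)) w.
    rewrite -(averaging_cst aL 0 w); apply: Lle; first exact: bmeas_cst.
      by apply/bmeas_expR/bmeasD; [exact: bmeasZ|exact: bmeas_cst].
    by move=> x; exact: expR_ge0.
  rewrite (le_trans (lerXn2r N _ _ Lq)) ?nnegrE//.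
    by rewrite (le_trans L0 Lq).
  rewrite (le_trans (lerXn2r N _ _ (expR_ge1Dx _))) ?nnegrE ?expR_ge0//.
    by rewrite (le_trans L0 Lq).
  by rewrite -expRM_natr ler_expR; lra.
have [r r1 rN] : exists2 r : R, 1 <= r & r ^+ 2 = N%:R.
  exists (Num.sqrt N%:R); last by rewrite sqr_sqrtr.
  by rewrite -[leLHS]sqrtr1 ler_wsqrtr// ler1n.
pose t : R := (4 * c * r)^-1.
have cr1 : 1 <= c * r by rewrite -[leLHS]mulr1 ler_pM.
have t0 : 0 < t by rewrite invr_gt0; lra.
have tE : t * (4 * c * r) = 1 by rewrite mulVf// gt_eqF//; lra.
have t2 : t ^+ 2 * (16 * c ^+ 2 * N%:R) = 1.
  transitivity ((t * (4 * c * r)) ^+ 2); first by rewrite -rN; ring.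
  by rewrite tE expr1n.
have tX4 : t ^+ 4 * \int[PU]_w (X w) ^+ 4 <= 48 * expR 1.
  rewrite -ExpZ//; last exact: bmeasX.
  have be (s : R) : bmeas (fun w => expR (s * X w)) by exact/bmeas_expR/bmeasZ.
  apply: (@le_trans _ _ (\int[PU]_w (24 * (expR (t * X w) + expR ((- t) * X w))))).
    apply: le_Exp => //; first exact/bmeasZ/bmeasX.
      by apply/bmeasZ/bmeasD.
    by move=> w; rewrite -exprMn mulNr; exact: expr4_le_expR.
  rewrite ExpZ ?ExpD//; last exact: bmeasD.
  (* By the choice of [t], t * 2 c = 1 / (2 sqrt N) and t^2 * 8 c^2 N = 1/2. *)
  have h1 : `|t * (2 * c)| <= 2^-1 by rewrite ger0_norm; nra.
  have h2 : t ^+ 2 * (8 * c ^+ 2) * N%:R <= 1 by lra.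
  have := expX t h1 h2.
  have := expX (- t); rewrite mulNr normrN sqrrN => /(_ h1 h2); lra.
have -> : \int[PU]_w (emp_mean f w - Lam f w) ^+ 4 =
    N%:R ^- 4 * \int[PU]_w X w ^+ 4.
  rewrite -ExpZ//; last exact: bmeasX.
  apply: eq_Rintegral => w _; rewrite -exprVn -exprMn; congr (_ ^+ _).
  by rewrite /X mulrBr mulKf// gt_eqF.
(* 12288 = 48 * 256, with 48 = 2 * 24 from the two exponentials and 256 = 4^4 from t^(-4). *)
have -> : 12288 * expR 1 * c ^+ 4 / N%:R ^+ 2 =
    N%:R ^- 4 * (t ^- 4 * (48 * expR 1)).
  have -> : t ^- 4 = 256 * c ^+ 4 * N%:R ^+ 2.
    apply: (mulfI (_ : t ^+ 4 != 0)); first by rewrite expf_neq0// gt_eqF.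
    rewrite mulfV ?expf_neq0 ?gt_eqF//.
    transitivity ((t ^+ 2 * (16 * c ^+ 2 * N%:R)) ^+ 2); last by ring.
    by rewrite t2 expr1n.
  by field; rewrite gt_eqF.
rewrite ler_wpM2l ?invr_ge0 ?exprn_ge0//.
by rewrite ler_pdivlMl// exprn_gt0.
Qed.

End conditionally_iid.

Lemma averaging_kernel (R : realType) dX dY (X : measurableType dX)
    (Y : measurableType dY) (k : R.-pker X ~> Y) :
  averaging (fun (f : Y -> R) x => \int[k x]_y f y).
Proof.
have k1 x : k x setT = 1%E by exact: prob_kernel.
have mpos f : bmeas f -> (forall y, 0 <= f y) ->
    measurable_fun setT (fun x => \int[k x]_y f y).
  move=> [mf _] f0; apply: measurableT_comp; first exact: fine_measurable.
  apply: (measurable_fun_integral_finite_kernel (fun z : X * Y => (f z.2)%:E)).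
    by move=> z; rewrite lee_fin.
  exact/measurable_EFinP/measurableT_comp.
split.
(* Adding the bound [C] reduces measurability in the parameter to the nonnegative case [mpos]. *)
- move=> f bf; have [C C1 fC] := bmeas_boundP bf.
  have bfC : bmeas (fun y => f y + C) by apply: bmeasD => //; exact: bmeas_cst.
  rewrite (_ : (fun x => _) = fun x => (\int[k x]_y (f y + C)) - C).
    apply: measurable_funB; last exact: measurable_cst.
    apply: mpos => // y; have := fC y; rewrite ler_norml => /andP[]; lra.
  apply/funext => x; rewrite ExpD//; last exact: bmeas_cst.
  by rewrite Exp_cst// addrK.
- by move=> f g x bf bg; rewrite ExpD.
- by move=> c f x bf; rewrite ExpZ.
- by move=> f g x bf bg fg; exact: le_Exp.
- by move=> x; rewrite Exp_cst.
Qed.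

(** * Functions of paths *)

Section paths_functions.
Context (R : realType) (d : nat -> measure_display)
  (E : forall n, measurableType (d n)).

Lemma plift_hist (T : Type) (X : forall n, T -> E n) p n (H : paths E p -> R) w :
  (p <= n)%N -> plift H (hist X n w) = H (hist X p w).
Proof.
move=> pn; rewrite -(subnKC pn); elim: (n - p)%N => [|k IH].
  by rewrite addn0 plift_id.
by rewrite addnS plift_succ ?leq_addr// -IH.
Qed.

Lemma plast_hist (T : Type) (X : forall n, T -> E n) n w :
  plast (hist X n w) = X n w.
Proof. by case: n. Qed.

Lemma measurable_hist dO (O : measurableType dO) (X : forall n, O -> E n) n :
  (forall n, measurable_fun setT (X n)) -> measurable_fun setT (hist X n).
Proof.
move=> mX; elim: n => [|n IH] /=; first exact: mX.
exact: measurable_fun_pair.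
Qed.

Lemma bmeas_plift p n (H : paths E p -> R) :
  bmeas H -> (p <= n)%N -> bmeas (plift H (n := n)).
Proof.
move=> bH pn; rewrite -(subnKC pn); elim: (n - p)%N => [|k IH].
  by rewrite addn0 plift_id.
rewrite addnS; apply: (eq_bmeas (f := fun y : paths E (p + k).+1 => plift H y.1)).
  by move=> y; rewrite plift_succ ?leq_addr.
by apply: (bmeas_comp (h := fst)) IH; exact: measurable_fst.
Qed.

Lemma plift_gt0 p n (H : paths E p -> R) (y : paths E n) :
  (p <= n)%N -> (forall z, 0 < H z) -> 0 < plift H y.
Proof.
move=> pn; move: y; rewrite -(subnKC pn); elim: (n - p)%N => [|k IH].
  by rewrite addn0 plift_id.
by rewrite addnS => y H0; rewrite plift_succ ?leq_addr//; exact: IH.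
Qed.

Context (K : forall n, R.-pker E n ~> E n.+1).

Lemma ptrans1 n (y : paths E n) : ptrans K n y setT = 1%E.
Proof. exact: prob_kernel. Qed.

Lemma Exp_ptrans n (y : paths E n) (f : paths E n.+1 -> R) : bmeas f ->
  \int[ptrans K n y]_z f z = \int[K n (plast y)]_x f (y, x).
Proof.
move=> bf; congr fine.
have my : measurable_fun setT (pair y : E n.+1 -> paths E n.+1).
  exact: pair1_measurable.
rewrite [LHS](integral_pushforward my)//.
  by apply/measurable_EFinP; case: bf.
rewrite preimage_setT.
apply: (bmeas_integrable _ (f := fun x => f (y, x))); first exact: prob_kernel.
exact: (bmeas_comp my).
Qed.

(** The historical transition only appends a coordinate: z.1 is [y], so a factor depending on the
    prefix is a constant. *)
Lemma Exp_ptransM n (y : paths E n) (f : paths E n.+1 -> R) (g : paths E n -> R) :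
  bmeas f -> bmeas g ->
  \int[ptrans K n y]_z (f z * g z.1) = (\int[ptrans K n y]_z f z) * g y.
Proof.
move=> bf bg; have bg1 : bmeas (fun z : paths E n.+1 => g z.1).
  by apply: (bmeas_comp (h := fst)) bg; exact: measurable_fst.
rewrite !Exp_ptrans//; last exact: bmeasM.
have bfy : bmeas (fun x => f (y, x)).
  by apply: (bmeas_comp (f := f) (h := pair y)) bf; exact: pair1_measurable.
have k1 : K n (plast y) setT = 1%E by exact: prob_kernel.
rewrite mulrC -(ExpZ k1 (g y) bfy).
by apply: eq_Rintegral => x _; rewrite mulrC.
Qed.

(** The future depends on the path through its last coordinate only. This links the conditional
    probability of the event, stated with the chain, to the path kernels of the recursions. *)
Lemma kexp_plast n (f : E n -> R) p (y : paths E p) : bmeas f -> (p <= n)%N ->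
  kexp K f (plast y) = kexp (ptrans K) (f \o @plast _ _ n) y.
Proof.
elim: n f p y => [|n IH] f p y bf.
  by case: p y => // y _; rewrite !kexp_id.
rewrite leq_eqVlt => /orP[/eqP pn|].
  by subst p; rewrite !kexp_id.
rewrite ltnS => pn; rewrite !kexp_succ// IH//; last first.
  exact: (averaging_bmeas (averaging_kernel (K n))).
apply: (congr1 (fun g => kexp (ptrans K) g y)); apply/funext => z /=.
rewrite Exp_ptrans//; apply: (bmeas_comp (f := f) (h := snd)) bf.
exact: measurable_snd.
Qed.

End paths_functions.

(** * One step of the chain, for bounded functions of the path *)

Section markov.
Context (R : realType) (d : nat -> measure_display)
  (E : forall n, measurableType (d n)).
Context (K : forall n, R.-pker E n ~> E n.+1) (x0 : E 0%N).
Context (dO : measure_display) (O : measurableType dO) (P : probability O R).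
Context (X : forall n, O -> E n) (hX : markov_chain K x0 P X).

Let mhist n : measurable_fun setT (hist X n).
Proof. by apply: measurable_hist; case: hX. Qed.

(** [markov_chain] gives the identity on rectangles only; these generate the product sigma-algebra
    and are stable under intersection, and both sides are probability measures in [A]. *)
Let markov_set n (A : set (paths E n.+1)) : measurable A ->
  P (hist X n.+1 @^-1` A) = (\int[P]_w ptrans K n (hist X n w) A)%E.
Proof.
have mh n' (B : set (paths E n')) : measurable B -> measurable (hist X n' @^-1` B).
  by move=> mB; rewrite -[X in measurable X]setTI; exact: mhist.
have mp B : measurable B -> measurable_fun setT (fun w => ptrans K n (hist X n w) B).
  move=> mB; apply: (measurableT_comp (measurable_kernel (ptrans K n) B mB)).
  exact: mhist.
have prodE : @measurable _ (paths E n.+1) =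
   <<s [set A `*` B | A in @measurable _ (paths E n) & B in @measurable _ (E n.+1)] >>.
  exact: measurable_prod_measurableType.
rewrite prodE; move: A; apply: dynkin_induction => //.
- move=> _ _ [A1 mA1 [A2 mA2 <-]] [B1 mB1 [B2 mB2 <-]].
  exists (A1 `&` B1); first exact: measurableI.
  exists (A2 `&` B2); first exact: measurableI.
  by rewrite setXI.
- rewrite preimage_setT; transitivity (1%E : \bar R); first exact: probability_setT.
  under eq_integral do rewrite ptrans1.
  by rewrite integral_cst// mul1e; exact/esym/probability_setT.
- move=> _ [C mC [A mA <-]].
  have [_ _ /(_ n C A mC mA) HM] := hX.
  rewrite (_ : _ @^-1` _ = hist X n @^-1` C `&` X n.+1 @^-1` A)//.
  rewrite HM integral_mkcond; apply: eq_integral => w _.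
  rewrite patchE -[ptrans _ _ _ _]/(K n (plast (hist X n w))
    [set x | (C `*` A) (hist X n w, x)]) plast_hist.
  case: ifPn => wC.
    congr (K n _ _); apply/seteqP; split => x //=; last by case.
    by move: wC; rewrite inE.
  rewrite (_ : [set x | _] = set0) ?measure0//.
  apply/seteqP; split => x //= -[hC _].
  by move/negP : wC; apply; rewrite inE.
- move=> S mS HS; rewrite preimage_setC (probability_setC P); last exact: mh.
  have mSC := measurableC mS.
  have tot : (\int[P]_w ptrans K n (hist X n w) (~` S) +
      \int[P]_w ptrans K n (hist X n w) S = 1)%E.
    rewrite -ge0_integralD//; [|exact: mp..].
    transitivity (\int[P]_w (cst 1%E w : \bar R))%E.
      apply: eq_integral => w _.
      have <- := measureU (ptrans K n (hist X n w)) mSC mS (setICl S).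
      by rewrite setvU; exact: ptrans1.
    by rewrite integral_cst// mul1e; exact: probability_setT.
  by rewrite -tot HS addeK// -HS; apply: fin_num_measure; exact: mh.
- move=> F mF tF HF; rewrite preimage_bigcup measure_semi_bigcup//.
  + rewrite (eq_eseriesr (fun k _ => HF k)) -integral_nneseries//.
    * apply: eq_integral => w _; rewrite measure_semi_bigcup//.
      exact: bigcup_measurable.
    * by move=> k; exact: mp.
  + by move=> k; exact: mh.
  + move=> i j _ _ [w [wi wj]]; apply: tF => //.
    by exists (hist X n.+1 w).
  + by apply: bigcup_measurable => k _; exact: mh.
Qed.

Lemma Exp_hist_succ n (f : paths E n.+1 -> R) : bmeas f ->
  \int[P]_w f (hist X n.+1 w) =
  \int[P]_w \int[ptrans K n (hist X n w)]_z f z.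
Proof.
move=> bf; have P1 := probability_setT P.
transitivity (\int[P]_w (1 * f (hist X n.+1 w))).
  by apply: eq_Rintegral => w _; rewrite mul1r.
transitivity (\int[P]_w (1 * \int[ptrans K n (hist X n w)]_z f z)); last first.
  by apply: eq_Rintegral => w _; rewrite mul1r.
have aM : averaging (fun (f : paths E n.+1 -> R) w => \int[ptrans K n (hist X n w)]_z f z).
  have [mM MD MZ Mle M1] := averaging_kernel (ptrans K n).
  split.
  - by move=> g bg; exact: (measurableT_comp (mM g bg) (@mhist n)).
  - by move=> g h w bg bh; exact: MD.
  - by move=> c g w bg; exact: MZ.
  - by move=> g h w bg bh gh; exact: Mle.
  - by move=> w; exact: M1.
have b1 : bmeas (fun _ : O => 1 : R) by exact: bmeas_cst.
apply: (eq_weighted_averaging P1 b1 b1 (averaging_comp R (@mhist n.+1)) aM _ bf).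
move=> A mA.
transitivity (\int[P]_w (\1_(hist X n.+1 @^-1` A) w : R)).
  by apply: eq_Rintegral => w _; rewrite mul1r.
rewrite Exp_indic; last by rewrite -[X in measurable X]setTI; exact: mhist.
transitivity (fine (\int[P]_w ptrans K n (hist X n w) A)%E).
  by congr fine; exact: markov_set.
congr fine; apply: eq_integral => w _.
rewrite mul1r Exp_indic// fineK// ge0_fin_numE//.
apply: (@le_lt_trans _ _ (ptrans K n (hist X n w) setT)).
  by apply: le_measure => //; rewrite inE.
by rewrite ptrans1 ltry.
Qed.

End markov.

(** Agreement on indicators is the definition of [empirical]; both sides are linear and bounded in
    sup norm. *)
Lemma Exp_empirical (R : realType) dT (T : measurableType dT) (N : nat)
    (x : 'I_N -> T) (f : T -> R) : (0 < N)%N -> bmeas f ->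
  \int[empirical x]_y f y = N%:R^-1 * \sum_i f (x i).
Proof.
move=> N0; have Nr0 : 0 < N%:R :> R by rewrite ltr0n.
have e1 : (empirical x : {measure set T -> \bar R}) setT = 1%E.
  rewrite /= /empirical; under eq_bigr do rewrite diracT.
  by rewrite sumEFin sumr_const card_ord -EFinM mulVf// gt_eqF.
move: f; apply: (@eq_bmeas_functional _ _ _ _ _ 1 1).
- by move=> f g bf bg; rewrite ExpD.
- by move=> c f bf; rewrite ExpZ.
- by move=> c f bf fc; rewrite mul1r; exact: Exp_norm_le.
- by move=> f g bf bg; rewrite big_split mulrDr.
- by move=> c f bf; rewrite -mulr_sumr mulrCA.
- move=> c f bf fc; rewrite mul1r normrM ger0_norm ?invr_ge0 ?ler0n//.
  rewrite mulrC ler_pdivrMr// (le_trans (ler_norm_sum _ _ _))//.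
  rewrite (le_trans (ler_sum _ (fun i _ => fc (x i))))//.
  by rewrite sumr_const card_ord mulr_natr.
- move=> A mA; rewrite Exp_indic//= /empirical.
  by rewrite sumEFin -EFinM.
Qed.

(** * Potentials and path weights *)

(** For a fixed path y0, the ratio bound traps G between G y0 / c and c G y0. On an empty path space
    any constants do. *)
Lemma potential_bounds (R : realType) (d : nat -> measure_display)
    (E : forall n, measurableType (d n)) (G : forall n, paths E n -> R) :
  potential G -> forall n, (0 < n)%N ->
  exists c C, 0 < c /\ forall y, c <= G n y <= C.
Proof.
move=> hG n n0; have [_ G0 [c Gc]] := hG n n0.
have [[y0 _]|no] := pselect (exists y : paths E n, True); last first.
  by exists 1, 1; split => // y; exfalso; apply: no; exists y.
have c1 : 1 <= c by have := Gc y0 y0; rewrite divff// gt_eqF.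
have c0 : 0 < c by exact: lt_le_trans c1.
exists (G n y0 / c), (c * G n y0); split; first by rewrite divr_gt0.
move=> y; rewrite ler_pdivrMr// mulrC -ler_pdivrMr// Gc/=.
by rewrite -ler_pdivrMr// Gc.
Qed.

Section path_weight.
Context (R : realType) (d : nat -> measure_display)
  (E : forall n, measurableType (d n)) (G : forall n, paths E n -> R).
Hypothesis hG : potential G.

(** Density of the law of the path with respect to gamma_n: E[f] = gamma_n(f path_weight). It is
    also the product occurring in [rare_T]. *)
Definition path_weight n (y : paths E n) : R :=
  \prod_(1 <= p < n) plift (pot_inv G (n := p)) y.

Lemma bmeas_potential n : (0 < n)%N -> bmeas (@G n).
Proof.
move=> n0; have [mG G0 _] := hG n0; split => //.
have [c [C [_ cC]]] := potential_bounds hG n0.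
by exists C => y; have /andP[_ yC] := cC y; rewrite ger0_norm// ltW.
Qed.

Lemma bmeas_pot_inv n : (0 < n)%N -> bmeas (pot_inv G (n := n)).
Proof.
move=> n0; have [c [C [c0 cC]]] := potential_bounds hG n0.
apply: (bmeasV c0); last exact: bmeas_potential.
by move=> y; have /andP[] := cC y.
Qed.

Lemma bmeas_path_weight n : bmeas (path_weight (n := n)).
Proof.
apply: bmeas_prod => p; rewrite mem_index_iota => /andP[p0 pn] _.
by apply: bmeas_plift; [exact: bmeas_pot_inv|exact: ltnW].
Qed.

Lemma path_weight_gt0 n (y : paths E n) : 0 < path_weight y.
Proof.
rewrite /path_weight big_nat_cond; apply: prodr_gt0 => p.
rewrite andbT => /andP[p0 pn]; apply: plift_gt0; first exact: ltnW.
by move=> z; have [_ G0 _] := hG p0; rewrite /pot_inv invr_gt0.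
Qed.

Lemma path_weight_succ n (z : paths E n.+1) : (0 < n)%N ->
  path_weight z = path_weight z.1 * (G z.1)^-1.
Proof.
move=> n0; rewrite /path_weight big_nat_recr//; congr (_ * _).
  rewrite big_nat_cond [RHS]big_nat_cond; apply: eq_bigr => p.
  by rewrite andbT => /andP[p0 pn]; rewrite plift_succ// ltnW.
by rewrite plift_succ// plift_id.
Qed.

Lemma path_weight_small n (y : paths E n) : (n <= 1)%N -> path_weight y = 1.
Proof. by move=> n1; rewrite /path_weight big_geq. Qed.

Lemma path_weight_hist (T : Type) (X : forall n, T -> E n) n w :
  path_weight (hist X n w) = \prod_(1 <= p < n) (G (hist X p w))^-1.
Proof.
rewrite /path_weight big_nat_cond [RHS]big_nat_cond; apply: eq_bigr => p.
by rewrite andbT => /andP[p0 pn]; rewrite plift_hist// ltnW.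
Qed.

Lemma bmeas_path_weightV n : bmeas (fun y : paths E n => (path_weight y)^-1).
Proof.
apply: (eq_bmeas (f := fun y => \prod_(1 <= p < n) plift (G (n := p)) y)).
  move=> y; rewrite /path_weight -prodfV big_nat_cond [RHS]big_nat_cond.
  apply: eq_bigr => p; rewrite andbT => /andP[p0 pn].
  move: y; rewrite -(subnKC (ltnW pn)); elim: (n - p)%N => [|k IH] y.
    by move: y; rewrite addn0 => y; rewrite !plift_id /pot_inv invrK.
  by move: y; rewrite addnS => y; rewrite !plift_succ ?leq_addr.
apply: bmeas_prod => p; rewrite mem_index_iota => /andP[p0 pn] _.
by apply: bmeas_plift; [exact: bmeas_potential|exact: ltnW].
Qed.

End path_weight.

(** * Moments of the particle estimators *)

Section particle_moments.
Context (R : realType) (d : nat -> measure_display)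
  (E : forall n, measurableType (d n)).
Context (K : forall n, R.-pker E n ~> E n.+1) (x0 : E 0%N).
Context (dO : measure_display) (O : measurableType dO) (P : probability O R).
Context (X : forall n, O -> E n) (hX : markov_chain K x0 P X).
Context (G : forall n, paths E n -> R) (hG : potential G).

Definition path_mean n (f : paths E n -> R) : R := \int[P]_w f (hist X n w).

Definition next_mean n (f : paths E n.+1 -> R) (y : paths E n) : R :=
  \int[ptrans K n y]_z f z.

Lemma bmeas_next_mean n (f : paths E n.+1 -> R) : bmeas f -> bmeas (next_mean f).
Proof. exact: (averaging_bmeas (averaging_kernel (ptrans K n))). Qed.

Lemma path_mean_succ n (f : paths E n.+1 -> R) : bmeas f ->
  path_mean f = path_mean (next_mean f).
Proof. exact: (Exp_hist_succ hX). Qed.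

Lemma FKgammaE n (f : paths E n -> R) :
  FKgamma P X G f = path_mean (fun y => f y * (path_weight G y)^-1).
Proof.
rewrite /FKgamma unlock; apply: eq_Rintegral => w _ /=.
by rewrite path_weight_hist prodfV invrK.
Qed.

Lemma FKgamma_invE n (f : paths E n -> R) :
  FKgamma P X (pot_inv G) f = path_mean (fun y => f y * path_weight G y).
Proof.
rewrite /FKgamma unlock; apply: eq_Rintegral => w _ /=.
by rewrite path_weight_hist.
Qed.

Context (dU : measure_display) (U : measurableType dU) (PU : probability U R).
Context (N : nat) (xi : forall n, 'I_N -> U -> paths E n).
Hypothesis N0 : (0 < N)%N.
Hypothesis hxi : particle_system K P X G PU xi.

(** Particle counterpart of gamma_n(1). It stops before generation [n], so it can serve as a past
    weight [H] when generation [n] is integrated out. *)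
Definition norm_est n (w : U) : R :=
  \prod_(1 <= k < n) emp_mean (xi k) (@G k) w.

(* The normalisation by [path_weight] makes [weighted_est n f] an unbiased
   estimator of [path_mean f]. *)
Definition weighted_est n (f : paths E n -> R) (w : U) : R :=
  if n == 0%N then path_mean f
  else norm_est n w * emp_mean (xi n) (fun y => f y * path_weight G y) w.

(** Conditional law of generation n.+1 given the past, that is [Phi] of the empirical measure of
    generation [n]. There are no particles at time 0: generation 1 follows the law of the chain, and
    the branch n == 0 lets the recursions start there. *)
Definition particle_law n (f : paths E n.+1 -> R) (w : U) : R :=
  if n == 0%N then path_mean f
  else emp_mean (xi n) (fun y => G y * next_mean f y) w /
       emp_mean (xi n) (@G n) w.

Let gens n : set (set U) := [set C | exists k (i : 'I_N) (A : set (paths E k)),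
  [/\ (0 < k <= n)%N, measurable A & C = xi k i @^-1` A] ].

Let past_type n : measurableType _ := g_sigma_algebraType (gens n).

Let mxi n i : (0 < n)%N -> measurable_fun setT (xi n i).
Proof. by move=> n0; case: hxi => + _ _; apply. Qed.

Let mgens n : gens n `<=` measurable.
Proof.
move=> _ [k [i [A [/andP[k0 _] mA ->]]]]; rewrite -[X in measurable X]setTI.
exact: mxi.
Qed.

Let past_xi k n i : (0 < k <= n)%N ->
  measurable_fun setT (xi k i : past_type n -> paths E k).
Proof.
move=> kn _ A mA; rewrite setTI; apply: sub_sigma_algebra.
by exists k, i, A.
Qed.

Let past_emp k n f : (0 < k <= n)%N -> bmeas f ->
  bmeas (emp_mean (xi k) f : past_type n -> R).
Proof.
move=> kn bf.
exact: (@emp_mean_bmeas _ _ (past_type n) _ _ _ (xi k) (fun i => past_xi i kn)).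
Qed.

Lemma emp_mean_potential n : (0 < n)%N ->
  exists2 c, 0 < c & forall w, c <= emp_mean (xi n) (@G n) w.
Proof.
move=> n0; have [c [C [c0 cC]]] := potential_bounds hG n0.
exists c => // w; rewrite /emp_mean ler_pdivlMl ?ltr0n//.
rewrite mulr_natl -[X in _ *+ X](card_ord N) -sumr_const; apply: ler_sum => i _.
by have /andP[] := cC (xi n i w).
Qed.

Lemma emp_mean_potential_gt0 n w : (0 < n)%N -> 0 < emp_mean (xi n) (@G n) w.
Proof. by move=> /emp_mean_potential[c c0 cG]; exact: lt_le_trans (cG w). Qed.

Let mhist n : measurable_fun setT (hist X n).
Proof. by apply: measurable_hist; case: hX. Qed.

Let bmeas_hist n (f : paths E n -> R) : bmeas f -> bmeas (fun w => f (hist X n w)).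
Proof. exact/bmeas_comp/mhist. Qed.

Let averaging_law n : averaging (@particle_law n : _ -> past_type n -> R).
Proof.
have P1 := probability_setT P.
rewrite /particle_law; case: eqVneq => [_|].
  split => [f bf|f g w bf bg|c f w bf|f g w bf bg fg|w].
  - exact: measurable_cst.
  - by rewrite /path_mean ExpD//; exact: bmeas_hist.
  - by rewrite /path_mean ExpZ//; exact: bmeas_hist.
  - by rewrite /path_mean; apply: le_Exp => //; exact: bmeas_hist.
  - by rewrite /path_mean Exp_cst.
rewrite -lt0n => n0; have [c c0 cG] := emp_mean_potential n0.
have [mM MD MZ Mle M1] := averaging_kernel (ptrans K n).
have nn : (0 < n <= n)%N by rewrite n0 leqnn.
have G0 w := emp_mean_potential_gt0 w n0.
have bG : bmeas (@G n) by exact: bmeas_potential.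
have bM (f : paths E n.+1 -> R) : bmeas f ->
    bmeas (fun y => G y * next_mean f y).
  by move=> bf; apply: bmeasM => //; exact: bmeas_next_mean.
split => [f bf|f g w bf bg|k f w bf|f g w bf bg fg|w].
- have bV := @bmeasV R _ (past_type n) _ c c0 cG (past_emp nn bG).
  by have [mf _] := bmeasM (past_emp nn (bM f bf)) bV; exact: mf.
- rewrite -mulrDl; congr (_ / _); rewrite /emp_mean -mulrDr -big_split/=.
  by congr (_ * _); apply: eq_bigr => i _; rewrite /next_mean MD// mulrDr.
- rewrite mulrA; congr (_ / _); rewrite /emp_mean mulrCA; congr (_ * _).
  rewrite mulr_sumr; apply: eq_bigr => i _.
  by rewrite /next_mean MZ// mulrCA.
- rewrite ler_pM2r ?invr_gt0// /emp_mean ler_pM2l ?invr_gt0 ?ltr0n//.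
  apply: ler_sum => i _; rewrite ler_pM2l; first exact: Mle.
  by case: (hG n0).
- rewrite (_ : (fun y => _) = @G n) ?divff ?gt_eqF//.
  by apply/funext => y; rewrite /next_mean M1 mulr1.
Qed.

Let law_particles n (A : 'I_N -> set (paths E n.+1)) (B : set U) :
  (forall i, measurable (A i)) -> <<s gens n >> B ->
  PU (B `&` \bigcap_i (xi n.+1 i @^-1` A i)) =
  (\int[PU]_(w in B) (\prod_i particle_law \1_(A i) w)%:E)%E.
Proof.
have [_ law1 lawS] := hxi; case: n A => [|n] A mA sB.
  (* Before generation 1 there are no generators, so the past is trivial. *)
  have [->|->] : B = set0 \/ B = setT.
    apply: (sB [set C | C = set0 \/ C = setT]); split.
    - split; first by left.
      + by move=> C [->|->]; rewrite ?setD0 ?setDv; [right|left].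
      + move=> F FE; have [[k FT]|no] := pselect (exists k, F k = setT).
          by right; apply/seteqP; split => // x _; exists k; rewrite ?FT.
        left; apply/seteqP; split => // x [k _].
        by have [->|FT] := FE k => //; exfalso; apply: no; exists k.
    - by move=> C [k [i [D [/andP[k0 k1]]]]]; move: k0; rewrite lt0n -leqn0 k1.
  + by rewrite set0I measure0 integral_set0.
  + rewrite setTI law1// /particle_law/= integral_cst//.
    rewrite [X in (_ * X)%E](_ : _ = 1%E) ?mule1; last exact: probability_setT.
    congr EFin; apply: eq_bigr => i _; rewrite /FKeta !FKgammaE.
    (* At time 1 the weight is an empty product, so eta_1 is the law of the path. *)
    have w1 (f : paths E 1 -> R) :
        path_mean (fun y => f y * (path_weight G y)^-1) = path_mean f.
      by apply: eq_Rintegral => w _; rewrite path_weight_small// invr1 mulr1.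
    by rewrite !w1 /path_mean Exp_cst ?divr1//; exact: probability_setT.
have n0 : (0 < n.+1)%N by [].
rewrite lawS//; apply: eq_integral => w _; congr EFin; apply: eq_bigr => i _.
rewrite /particle_law /= /Phi.
have -> : (fun y => G y * fine (ptrans K n.+1 y (A i))) =
    (fun y => G y * next_mean \1_(A i) y).
  by apply/funext => y; rewrite /next_mean Exp_indic.
have bG : bmeas (@G n.+1) by exact: bmeas_potential.
rewrite !Exp_empirical//; apply: bmeasM => //.
by apply: bmeas_next_mean; exact: bmeas_indic.
Qed.

Lemma norm_est_gt0 n w : 0 < norm_est n w.
Proof.
rewrite /norm_est big_nat_cond; apply: prodr_gt0 => k.
by rewrite andbT => /andP[k0 _]; exact: emp_mean_potential_gt0.
Qed.

Lemma norm_est_le (C : nat -> R) n w :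
  (forall k, (0 < k)%N -> forall y : paths E k, `|G y| <= C k) ->
  norm_est n w <= \prod_(1 <= k < n) C k.
Proof.
move=> GC; rewrite /norm_est big_nat_cond [leRHS]big_nat_cond; apply: ler_prod => k.
rewrite andbT => /andP[k0 _]; rewrite ltW ?emp_mean_potential_gt0//=.
rewrite (le_trans (ler_norm _))//; apply: emp_mean_norm_le => //.
exact: GC.
Qed.

Let past_norm_est n : bmeas (norm_est n.+1 : past_type n -> R).
Proof.
apply: bmeas_prod => k; rewrite mem_index_iota => kn _.
by apply: past_emp => //; apply: bmeas_potential => //; case/andP : kn.
Qed.

Let bmeas_norm_est n : bmeas (norm_est n).
Proof.
case: n => [|n]; last by apply: (past_bmeas (@mgens n)); exact: past_norm_est.
by apply: eq_bmeas (bmeas_cst _ 1) => w; rewrite /norm_est big_geq.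
Qed.

Let bmeasW n (f : paths E n -> R) :
  bmeas f -> bmeas (fun y => f y * path_weight G y).
Proof. by move=> bf; apply: bmeasM => //; exact: bmeas_path_weight. Qed.

Lemma bmeas_weighted_est n (f : paths E n -> R) : bmeas f -> bmeas (weighted_est f).
Proof.
move=> bf; rewrite /weighted_est; case: eqVneq => n0; first exact: bmeas_cst.
apply: bmeasM => //; apply: emp_mean_bmeas; last exact: bmeasW.
by move=> i; apply: mxi; rewrite lt0n.
Qed.

(** Two cancellations give the martingale structure: the last factor of [norm_est] removes the
    denominator of [particle_law], and the factor 1 / G_n gained by the path weight removes the
    selection by G_n in its numerator. *)
Lemma norm_est_law n (f : paths E n.+1 -> R) w : bmeas f ->
  norm_est n.+1 w * particle_law (fun y => f y * path_weight G y) w =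
  weighted_est (next_mean f) w.
Proof.
move=> bf; rewrite /particle_law /weighted_est; case: eqVneq => [n0|].
  rewrite {1}/norm_est big_geq ?n0// mul1r -path_mean_succ//.
  by apply: eq_Rintegral => v _; rewrite path_weight_small ?mulr1// n0.
rewrite -lt0n => n0; rewrite /norm_est big_nat_recr//.
have eG0 := emp_mean_potential_gt0 w n0.
have cancel (a b c : R) : b != 0 -> a * b * (c / b) = a * c by move=> b0; field.
rewrite cancel ?gt_eqF//; congr (_ * (_ * _)); apply: eq_bigr => i _.
set y := xi n i w.
have -> : next_mean (fun z => f z * path_weight G z) y =
    next_mean (fun z => f z * (path_weight G z.1 * (G z.1)^-1)) y.
  by apply: eq_Rintegral => z _; rewrite path_weight_succ.
have bGV : bmeas (fun y : paths E n => path_weight G y * (G y)^-1).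
  by apply: bmeasM; [exact: bmeas_path_weight|exact: bmeas_pot_inv].
rewrite /next_mean (Exp_ptransM K y bf bGV) mulrC -!mulrA mulVf ?mulr1//.
by rewrite gt_eqF//; case: (hG n0).
Qed.

(** Integrating out the last generation replaces f by [next_mean f] one generation earlier, down to
    time 0, where the estimator is exact. *)
Lemma Exp_weighted_est n (f : paths E n -> R) : bmeas f ->
  \int[PU]_w weighted_est f w = path_mean f.
Proof.
elim: n f => [|n IH] f bf.
  by rewrite /weighted_est eqxx Exp_cst//; exact: probability_setT.
have := Exp_emp_mean (@mgens n) (fun i => @mxi n.+1 i isT) (@averaging_law n)
  (@law_particles n) N0 (past_norm_est n) (bmeasW bf).
rewrite -[LHS]/(\int[PU]_w weighted_est f w) => ->.
under eq_Rintegral do rewrite norm_est_law//.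
by rewrite IH ?path_mean_succ//; exact: bmeas_next_mean.
Qed.

(** The diagonal pairs leave norm_est^2 Lam (path_weight^2 f g). As Lam (path_weight^-1 path_weight)
    = 1, this splits into two one-step predictions, for path_weight^-1 and path_weight f g, so the
    recursion stays among products of estimators. *)
Lemma Exp_weighted_estM n (f g : paths E n.+1 -> R) : bmeas f -> bmeas g ->
  \int[PU]_w (weighted_est f w * weighted_est g w) =
  (1 - N%:R^-1) * \int[PU]_w (weighted_est (next_mean f) w *
                              weighted_est (next_mean g) w) +
  N%:R^-1 * \int[PU]_w
    (weighted_est (next_mean (fun y : paths E n.+1 => (path_weight G y)^-1)) w *
     weighted_est (next_mean (fun y : paths E n.+1 => path_weight G y * f y * g y)) w).
Proof.
move=> bf bg; pose H w := norm_est n.+1 w * norm_est n.+1 w.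
have bH : bmeas (H : past_type n -> R).
  exact: bmeasM (past_norm_est n) (past_norm_est n).
have bV := bmeas_path_weightV hG n.+1.
have bwfg : bmeas (fun y : paths E n.+1 => path_weight G y * f y * g y).
  by do 2 (apply: bmeasM => //); exact: bmeas_path_weight.
have := Exp_emp_meanM (@mgens n) (fun i => @mxi n.+1 i isT) (@averaging_law n)
  (@law_particles n) N0 bH (bmeasW bf) (bmeasW bg).
under eq_Rintegral do rewrite /H mulrACA.
rewrite -[LHS]/(\int[PU]_w (weighted_est f w * weighted_est g w)) => ->.
congr (_ * _ + _ * _); apply: eq_Rintegral => w _.
  by rewrite /H mulrACA !norm_est_law.
rewrite -(norm_est_law w bV) -(norm_est_law w bwfg) /H -mulrA [RHS]mulrACA mulrA.
congr (_ * _).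
have aL := averaging_past (@mgens n) (@averaging_law n).
rewrite (_ : (fun y => (path_weight G y)^-1 * path_weight G y) = fun=> 1).
  rewrite (averaging_cst aL) mul1r; congr (particle_law _ w).
  by apply/funext => y; ring.
by apply/funext => y; rewrite mulVf// gt_eqF// path_weight_gt0.
Qed.

(** The error is the fresh sampling error of the last generation, scaled by [norm_est], plus the
    error of the previous estimator for [next_mean f]. *)
Lemma Exp_weighted_est4 n (f : paths E n.+1 -> R) (c D : R) : bmeas f -> 1 <= c ->
  (forall y, `|f y * path_weight G y| <= c) -> (forall w, norm_est n.+1 w <= D) ->
  \int[PU]_w (weighted_est f w - path_mean f) ^+ 4 <=
  8 * (D ^+ 4 * ((12288 * expR 1) * c ^+ 4 / N%:R ^+ 2) +
  \int[PU]_w (weighted_est (next_mean f) w - path_mean (next_mean f)) ^+ 4).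
Proof.
move=> bf c1 fc ND; have PU1 : PU setT = 1%E := probability_setT PU.
have bfW := bmeasW bf.
have := Exp_emp_mean_sub4 (@mgens n) (fun i => @mxi n.+1 i isT) (@averaging_law n)
  (@law_particles n) N0 c1 bfW fc.
set M := _ / _; set e := emp_mean _ _; set l := particle_law _ => eM.
have be : bmeas e by apply: emp_mean_bmeas => // i; exact: mxi.
have bl : bmeas l.
  by apply: averaging_bmeas bfW; exact: averaging_past (@mgens n) (@averaging_law n).
have bW1 : bmeas (weighted_est (next_mean f)).
  by apply: bmeas_weighted_est; exact: bmeas_next_mean.
have bx : bmeas (fun w => (e w - l w) ^+ 4) by exact/bmeasX/bmeasB.
have bz : bmeas (fun w =>
    (weighted_est (next_mean f) w - path_mean (next_mean f)) ^+ 4).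
  by apply/bmeasX/bmeasB => //; exact: bmeas_cst.
have D0 : 0 <= D ^+ 4 by rewrite exprn_even_ge0.
apply: (@le_trans _ _ (\int[PU]_w (8 * (D ^+ 4 * (e w - l w) ^+ 4 +
    (weighted_est (next_mean f) w - path_mean (next_mean f)) ^+ 4)))).
  apply: le_Exp => //.
  - apply/bmeasX/bmeasB; last exact: bmeas_cst.
    exact: bmeas_weighted_est.
  - by apply/bmeasZ/bmeasD => //; exact: bmeasZ.
  move=> w; rewrite path_mean_succ//.
  have -> : weighted_est f w - path_mean (next_mean f) =
      norm_est n.+1 w * (e w - l w) +
      (weighted_est (next_mean f) w - path_mean (next_mean f)).
    by rewrite -norm_est_law// -/l mulrBr addrA subrK.
  set u := norm_est n.+1 w * _; set v := weighted_est _ _ - _.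
  have uD : u ^+ 4 <= D ^+ 4 * (e w - l w) ^+ 4.
    rewrite exprMn ler_wpM2r ?exprn_even_ge0// lerXn2r ?nnegrE//.
      exact/ltW/norm_est_gt0.
    exact: le_trans (ltW (norm_est_gt0 n.+1 w)) (ND w).
  suff : (u + v) ^+ 4 <= 8 * (u ^+ 4 + v ^+ 4) by lra.
  (* The last factor is 5 (u + v)^2 + 2 u^2 + 2 v^2. *)
  have -> : 8 * (u ^+ 4 + v ^+ 4) = (u + v) ^+ 4 +
      (u - v) ^+ 2 * (7 * u ^+ 2 + 10 * u * v + 7 * v ^+ 2) by ring.
  rewrite lerDl mulr_ge0 ?sqr_ge0//.
  have := sqr_ge0 (u + v); have := sqr_ge0 u; have := sqr_ge0 v; nra.
rewrite ExpZ ?ExpD// ?ExpZ//; [|exact: bmeasZ|by apply: bmeasD => //; exact: bmeasZ].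
by rewrite ler_pM2l// lerD2r ler_wpM2l.
Qed.

End particle_moments.

(** * Asymptotics in the number of particles *)

Section asymptotics.
Context (R : realType) (d : nat -> measure_display)
  (E : forall n, measurableType (d n)).
Context (K : forall n, R.-pker E n ~> E n.+1) (x0 : E 0%N).
Context (dO : measure_display) (O : measurableType dO) (P : probability O R).
Context (X : forall n, O -> E n) (hX : markov_chain K x0 P X).
Context (G : forall n, paths E n -> R) (hG : potential G).
Context (dU : nat -> measure_display) (U : forall N, measurableType (dU N)).
Context (PU : forall N, probability (U N) R).
Context (xi : forall N n, 'I_N -> U N -> paths E n).
Hypothesis hxi : forall N, (0 < N)%N -> particle_system K P X G (PU N) (@xi N).

Local Notation Est N f := (weighted_est P X G (@xi N) f).
Local Notation pi f := (path_mean P X f).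
Local Notation next f := (next_mean K f).

Lemma cvg_invn : (fun N : nat => N%:R^-1 : R) @ \oo --> (0 : R).
Proof.
apply/(gtr0_cvgV0 _).2; last exact: cvgr_idn.
by near=> N; rewrite ltr0n; near: N; exact: nbhs_infty_gt.
Unshelve. all: by end_near. Qed.

(** Each generation adds a term of order N^-2, with a constant uniform in N because the bounds on
    the potentials give a deterministic [D] above [norm_est]. *)
Lemma weighted_est_moment4 n (f : paths E n -> R) : bmeas f ->
  exists C, forall N, (0 < N)%N ->
    \int[PU N]_w (Est N f w - pi f) ^+ 4 <= C / N%:R ^+ 2.
Proof.
elim: n f => [|n IH] f bf.
  exists 0 => N N0; rewrite mul0r /weighted_est eqxx subrr expr0n/=.
  by rewrite Exp_cst//; exact: probability_setT.
have bfW : bmeas (fun y => f y * path_weight G y).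
  by apply: bmeasM => //; exact: bmeas_path_weight.
have [c c1 fc] := bmeas_boundP bfW.
have /choice[B GB] : forall k, exists B, (0 < k)%N -> forall y : paths E k, `|G y| <= B.
  move=> k; have [k0|k0] := posnP k; first by exists 0; rewrite k0.
  by have [_ [B GB]] := bmeas_potential hG k0; exists B.
pose D := \prod_(1 <= k < n.+1) B k.
have [C HC] := IH _ (bmeas_next_mean K bf).
exists (8 * (D ^+ 4 * ((12288 * expR 1) * c ^+ 4) + C)) => N N0.
have ND w : norm_est G (@xi N) n.+1 w <= D.
  exact: norm_est_le.
rewrite (le_trans (Exp_weighted_est4 hX hG N0 (hxi N0) bf c1 fc ND))//.
rewrite -[leRHS]mulrA ler_pM2l// [leRHS]mulrDl; apply: lerD; last exact: HC.
by rewrite [leLHS]mulrA.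
Qed.

(** The term of index p is the covariance created by sampling generation p: the mean of
    path_weight^-1 is gamma_p(1), and weighting by path_weight gives gamma_p^-. *)
Definition asymp_cov n (f g : paths E n -> R) : R :=
  \sum_(1 <= p < n.+1)
    (pi (fun y : paths E p => (path_weight G y)^-1) *
     pi (fun y : paths E p => path_weight G y *
       kexp (ptrans K) f y * kexp (ptrans K) g y) - pi f * pi g).

Lemma asymp_cov_succ n (f g : paths E n.+1 -> R) : bmeas f -> bmeas g ->
  asymp_cov f g = asymp_cov (next f) (next g) +
    (pi (next (fun y : paths E n.+1 => (path_weight G y)^-1)) *
     pi (next (fun y : paths E n.+1 => path_weight G y * f y * g y)) -
     pi (next f) * pi (next g)).
Proof.
move=> bf bg; rewrite /asymp_cov big_nat_recr//.
rewrite -!(path_mean_succ hX)//; last 2 first.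
- by do 2 (apply: bmeasM => //); exact: bmeas_path_weight.
- exact: bmeas_path_weightV.
congr (_ + _); last by rewrite !kexp_id.
rewrite big_nat_cond [RHS]big_nat_cond; apply: eq_bigr => p.
rewrite andbT ltnS => /andP[_ pn]; congr (_ * path_mean P X _ - _).
by apply/funext => y; rewrite !(kexp_succ _ _ pn).
Qed.

(** With m the limit and E_n the mean product for the [next] functions, the exact recursion reads N
    (E_(n+1) - m) = N (E_n - m) + Q - E_n, where Q is the diagonal term. Induction gives the limit
    of the first summand and, after division by N, those of Q and E_n. *)
Lemma weighted_est_cov n (f g : paths E n -> R) : bmeas f -> bmeas g ->
  (fun N : nat => N%:R *
    (\int[PU N]_w (Est N f w * Est N g w) - pi f * pi g)) @ \oo -->
  asymp_cov f g.
Proof.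
elim: n f g => [|n IH] f g bf bg.
  rewrite /asymp_cov big_geq//; apply: cvg_near_cst; near=> N.
  rewrite /weighted_est eqxx Exp_cst ?subrr ?mulr0//; exact: probability_setT.
have consistent (h k : paths E n -> R) : bmeas h -> bmeas k ->
    (fun N : nat => \int[PU N]_w (Est N h w * Est N k w)) @ \oo -->
    pi h * pi k.
  move=> bh bk.
  have := cvgD (cvgM cvg_invn (IH h k bh bk)) (cvg_cst (pi h * pi k)).
  rewrite mul0r add0r => lim_eq; apply: (cvg_trans _ (lim_eq _ _ _)).
  apply: near_eq_cvg; near=> N.
  have N0 : N%:R != 0 :> R.
    by rewrite pnatr_eq0 -lt0n; near: N; exact: nbhs_infty_gt.
  by rewrite !fctE/= mulKf// subrK.
have bwfg : bmeas (fun y : paths E n.+1 => path_weight G y * f y * g y).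
  by do 2 (apply: bmeasM => //); exact: bmeas_path_weight.
have bnf := bmeas_next_mean K bf; have bng := bmeas_next_mean K bg.
have bV := bmeas_next_mean K (bmeas_path_weightV hG n.+1).
have bW := bmeas_next_mean K bwfg.
have := cvgD (IH _ _ bnf bng)
  (cvgB (consistent _ _ bV bW) (consistent _ _ bnf bng)).
rewrite -asymp_cov_succ// => lim_eq; apply: (cvg_trans _ (lim_eq _ _)).
apply: near_eq_cvg; near=> N.
have N0 : (0 < N)%N by near: N; exact: nbhs_infty_gt.
have Nr0 : N%:R != 0 :> R by rewrite pnatr_eq0 -lt0n.
rewrite !fctE/= (Exp_weighted_estM hX hG N0 (hxi N0) bf bg).
rewrite (path_mean_succ hX bf) (path_mean_succ hX bg).
move: N%:R Nr0 (\int[PU N]_w _) (\int[PU N]_w _) (pi _ * pi _) => r r0 A B m.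
by field.
Unshelve. all: by end_near. Qed.

End asymptotics.

(** * Bias of a ratio of estimators *)

Lemma cvg_ratio_bias (R : realType) (dU : nat -> measure_display)
    (U : forall N, measurableType (dU N)) (PU : forall N, probability (U N) R)
    (A B D : forall N, U N -> R) (b c S CA CB : R) :
  0 < b ->
  (forall N, (0 < N)%N -> [/\ bmeas (A N), bmeas (B N) & bmeas (D N)]) ->
  (forall N w, (0 < N)%N -> A N w = D N w * B N w) ->
  (forall N w, (0 < N)%N -> `|D N w| <= c) ->
  (forall N, (0 < N)%N -> \int[PU N]_w A N w = 0) ->
  (forall N, (0 < N)%N -> \int[PU N]_w A N w ^+ 4 <= CA / N%:R ^+ 2) ->
  (forall N, (0 < N)%N -> \int[PU N]_w (B N w - b) ^+ 4 <= CB / N%:R ^+ 2) ->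
  (fun N => N%:R * \int[PU N]_w (A N w * B N w)) @ \oo --> S ->
  (fun N => N%:R * \int[PU N]_w D N w) @ \oo --> - b ^- 2 * S.
Proof.
move=> b0 bABD ADB Dc A0 A4 B4 AB.
pose rem N := N%:R * \int[PU N]_w (D N w * (B N w - b) ^+ 2).
have brem N : (0 < N)%N -> bmeas (fun w => D N w * (B N w - b) ^+ 2).
  move=> N0; have [bA bB bD] := bABD _ N0; apply: bmeasM => //.
  by apply: bmeasX; apply: bmeasB => //; exact: bmeas_cst.
(* What remains of the bound with [k1], [k2], [k3] below once multiplied by N: each of its three
   terms is a constant times N^(-1/2). *)
pose kappa := b^-1 * (CA / 4 + (1 + c) / 4 + (2 + 3 * c) / 4 * CB).
have rem_le N : (0 < N)%N -> `|rem N| <= kappa * Num.sqrt N%:R^-1.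
  move=> N0; have [bA bB bD] := bABD _ N0.
  have P1 := probability_setT (PU N).
  have Nr0 : 0 < N%:R :> R by rewrite ltr0n.
  (* [q] = N^(-1/2) is the typical size of A and B - b, hence the scale that balances [key]. *)
  have [q q0 [qN ->]] : exists2 q : R, 0 < q &
      q ^+ 2 * N%:R = 1 /\ Num.sqrt N%:R^-1 = q.
    exists (Num.sqrt N%:R^-1); first by rewrite sqrtr_gt0 invr_gt0.
    by rewrite sqr_sqrtr ?invr_ge0 ?ler0n// mulVf// gt_eqF.
  have bB4 : bmeas (fun w => (B N w - b) ^+ 4).
    by apply: bmeasX; apply: bmeasB => //; exact: bmeas_cst.
  have bA4 : bmeas (fun w => A N w ^+ 4) by exact: bmeasX.
  pose k1 : R := b^-1 * (4 * q)^-1; pose k2 := b^-1 * ((1 + c) * q ^+ 3 / 4).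
  pose k3 := b^-1 * ((2 + 3 * c) / (4 * q)).
  (* With [x = B - b], [b D = A - D x] gives [b |D| x^2 <= |A| x^2 + c |x|^3],
     and [key] bounds both terms by fourth powers. *)
  have pointwise w : `|D N w * (B N w - b) ^+ 2| <=
      k1 * A N w ^+ 4 + (k2 + k3 * (B N w - b) ^+ 4).
    have key (z y : R) : 0 <= z -> 0 <= y ->
        z * y ^+ 2 <= (4 * q)^-1 * (z ^+ 4 + q ^+ 4 + 2 * y ^+ 4).
      move=> z0 y0; rewrite ler_pdivlMl ?mulr_gt0//.
      (* Twice the first square plus the second is z^4 + q^4 + 2 y^4 - 4 q z y^2. *)
      have := sqr_ge0 (q * z - y ^+ 2); have := sqr_ge0 (q ^+ 2 - z ^+ 2); lra.
    set x := B N w - b; have c0 : 0 <= c by exact: le_trans (Dc N w N0).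
    have DE : D N w = b^-1 * (A N w - D N w * x).
      by rewrite ADB// /x; field; rewrite gt_eqF.
    have k1E : k1 * A N w ^+ 4 + (k2 + k3 * x ^+ 4) =
      b^-1 * ((4 * q)^-1 * (`|A N w| ^+ 4 + q ^+ 4 + 2 * `|x| ^+ 4) +
      c * ((4 * q)^-1 * (`|x| ^+ 4 + q ^+ 4 + 2 * `|x| ^+ 4))).
      have n4 (z : R) : `|z| ^+ 4 = z ^+ 4 by rewrite -normrX ger0_norm// exprn_even_ge0.
      rewrite !n4 /k1 /k2 /k3; field; by rewrite !gt_eqF.
    rewrite k1E DE -mulrA normrM ger0_norm ?invr_ge0 1?(ltW b0)//.
    rewrite ler_pM2l ?invr_gt0// mulrBl (le_trans (ler_normB _ _))//.
    rewrite lerD//; first by rewrite normrM normrX key.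
    rewrite -mulrA normrM ler_pM//; first exact: Dc.
    by rewrite -exprS normrX (le_trans _ (key _ _ _ _))// -exprS.
  have int_le : `|\int[PU N]_w (D N w * (B N w - b) ^+ 2)| <=
      k1 * (CA / N%:R ^+ 2) + (k2 + k3 * (CB / N%:R ^+ 2)).
    have bk3 : bmeas (fun w => k3 * (B N w - b) ^+ 4) by exact: bmeasZ.
    have bk1 : bmeas (fun w => k1 * A N w ^+ 4) by exact: bmeasZ.
    have bk2 : bmeas (fun _ : U N => k2) by exact: bmeas_cst.
    have bk23 : bmeas (fun w => k2 + k3 * (B N w - b) ^+ 4) by exact: bmeasD.
    have bk : bmeas (fun w => k1 * A N w ^+ 4 + (k2 + k3 * (B N w - b) ^+ 4)).
      exact: bmeasD.
    apply: (@le_trans _ _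
        (\int[PU N]_w (k1 * A N w ^+ 4 + (k2 + k3 * (B N w - b) ^+ 4)))).
      have bn := brem N N0.
      rewrite ler_norml; apply/andP; split.
        rewrite lerNl -mulN1r -ExpZ//; apply: le_Exp => //; first exact: bmeasZ.
        by move=> w; rewrite mulN1r (le_trans _ (pointwise w))// -normrN ler_norm.
      apply: le_Exp => // w; exact: le_trans (ler_norm _) (pointwise w).
    rewrite ExpD// ExpD// Exp_cst// !ExpZ//.
    have k10 : 0 <= k1 by rewrite mulr_ge0 ?invr_ge0 ?mulr_ge0 ?ltW.
    have c0 : 0 <= c by exact: le_trans (Dc N point N0).
    have k30 : 0 <= k3.
      apply: mulr_ge0; first by rewrite invr_ge0 ltW.
      by apply: divr_ge0; lra.
    apply: lerD; first by apply: ler_wpM2l => //; exact: A4.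
    by rewrite lerD2l; apply: ler_wpM2l => //; exact: B4.
  rewrite /rem normrM ger0_norm ?ler0n//.
  rewrite (le_trans (ler_wpM2l (ler0n _ _) int_le))//.
  have NE : N%:R = q ^- 2 :> R.
    have q2 : q ^+ 2 != 0 by rewrite expf_neq0// gt_eqF.
    by apply: (mulfI q2); rewrite qN mulfV.
  rewrite le_eqVlt; apply/orP; left; apply/eqP.
  by rewrite NE /k1 /k2 /k3 /kappa; field; rewrite !gt_eqF.
have rem0 : rem @ \oo --> (0 : R).
  have q0 : (fun N => kappa * Num.sqrt N%:R^-1) @ \oo --> (0 : R).
    have := cvgM (cvg_cst kappa)
      (continuous_cvg _ (@sqrt_continuous R 0) (@cvg_invn R)).
    rewrite sqrtr0 mulr0; exact.
  apply/norm_cvg0P.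
  apply: (squeeze_cvgr _ (cvg_cst 0) q0); near=> N.
  by rewrite normr_ge0/= rem_le//; near: N; exact: nbhs_infty_gt.
have lim_eq := cvgD (cvgM (cvg_cst (- b ^- 2)) AB) (cvgM (cvg_cst (b ^- 2)) rem0).
move: lim_eq; rewrite mulr0 addr0 => lim_eq.
apply: (cvg_trans _ (lim_eq _ _ _ _ _)); apply: near_eq_cvg; near=> N.
have N0 : (0 < N)%N by near: N; exact: nbhs_infty_gt.
have [bA bB bD] := bABD _ N0; have P1 := probability_setT (PU N).
rewrite !fctE/= /rem.
have -> : \int[PU N]_w D N w = b ^- 2 * (2 * b * \int[PU N]_w A N w -
    \int[PU N]_w (A N w * B N w) + \int[PU N]_w (D N w * (B N w - b) ^+ 2)).
  have bAB : bmeas (fun w => A N w * B N w) by exact: bmeasM.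
  have bA' : bmeas (fun w => 2 * b * A N w) by exact: bmeasZ.
  have bAA : bmeas (fun w => 2 * b * A N w - A N w * B N w) by exact: bmeasB.
  rewrite -ExpZ// -ExpB// -ExpD//; last exact: brem.
  rewrite -ExpZ//; last by apply: bmeasD => //; exact: brem.
  by apply: eq_Rintegral => w _; rewrite ADB//; field; rewrite gt_eqF.
rewrite A0//; ring.
Unshelve. all: by end_near. Qed.

(** * Asymptotic bias of the conditional mean estimator *)

Theorem theorem2p5 (R : realType) (d : nat -> measure_display)
  (E : forall n, measurableType (d n)) (K : forall n, R.-pker E n ~> E n.+1)
  (x0 : E 0%N)
  (dO : measure_display) (O : measurableType dO) (P : probability O R)
  (X : forall n, O -> E n) (hX : markov_chain K x0 P X)
  (G : forall n, paths E n -> R) (hG : potential G)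
  (dU : nat -> measure_display) (U : forall N, measurableType (dU N))
  (PU : forall N, probability (U N) R)
  (xi : forall N n, 'I_N -> U N -> paths E n)
  (hxi : forall N, (0 < N)%N -> particle_system K P X G (PU N) (xi N))
  (n : nat) (hn : (1 <= n)%N)
  (V : E n -> R) (mV : measurable_fun setT V)
  (a : R) (ha : 0 < rare_prob P X V a)
  (phi : paths E n -> R) (mphi : measurable_fun setT phi)
  (bphi : bounded_fun phi) :
  (fun N : nat => N%:R *
     fine 'E_(PU N)[fun w =>
       (rare_mean_est G V a (xi N) phi w - rare_mean P X V a phi)
       * \1_[set w' | 0 < rare_prob_est G V a (xi N) w'] w]) @ \oo -->
  - (rare_prob P X V a) ^- 2 *
    \sum_(1 <= p < n.+1)
      FKgamma P X G (fun _ : paths E p => 1) *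
      FKgamma P X (pot_inv G) (fun _ : paths E p => 1) *
      FKeta P X (pot_inv G)
        (fun y : paths E p => cond_prob K V a y * cond_mean K P X V a phi y).
Proof.
have P1 := probability_setT P.
set b := rare_prob P X V a in ha *; set m := rare_mean P X V a phi.
have mX : forall k, measurable_fun setT (X k) by case: hX.
have mL : measurable (level_set V a).
  rewrite (_ : level_set V a = V @^-1` `[a, +oo[%classic).
    by rewrite -[X in measurable X]setTI; exact: mV.
  by apply/seteqP; split => x /=; rewrite /level_set/= in_itv/= andbT.
have bL : bmeas (\1_(level_set V a) : E n -> R) by exact: bmeas_indic.
pose one (y : paths E n) : R := \1_(level_set V a) (plast y).
have bone : bmeas one by exact: (bmeas_comp (@measurable_plast _ _ n) bL).
have bmphi : bmeas phi.
  split => //; have [M [_ Mphi]] := bphi.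
  by exists (M + 1) => y; apply: Mphi => //; rewrite ltrDl.
(* Centring at the conditional mean makes [path_mean fm] vanish, which removes the product term from
   each summand of [asymp_cov]. *)
pose fm y := (phi y - m) * one y.
have bpm : bmeas (fun y => phi y - m) by apply: bmeasB => //; exact: bmeas_cst.
have bfm : bmeas fm by exact: bmeasM.
have bhist (f : paths E n -> R) : bmeas f -> bmeas (fun w => f (hist X n w)).
  exact: (bmeas_comp (measurable_hist (n := n) mX)).
have pione : path_mean P X one = b.
  rewrite /path_mean /b /rare_prob -Exp_indic; last first.
    by rewrite -[X in measurable X]setTI; exact: mX.
  by apply: eq_Rintegral => w _; rewrite /one plast_hist.
have pifm : path_mean P X fm = 0.
  have b1 := bhist _ (bmeasM bmphi bone).
  have b2 := bmeasZ m (bhist _ bone).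
  transitivity (\int[P]_w (phi (hist X n w) * one (hist X n w)) - m * b).
    rewrite -pione /path_mean -ExpZ//; last exact: bhist.
    by rewrite -ExpB//; apply: eq_Rintegral => w _; rewrite /fm mulrBl.
  rewrite /m /rare_mean -/b mulfVK ?gt_eqF// unlock.
  apply/eqP; rewrite subr_eq0; apply/eqP; apply: eq_Rintegral => w _.
  by rewrite /one plast_hist.
have [c c1 pmc] := bmeas_boundP bpm.
pose e N f := emp_mean (xi N n) (fun y => f y * path_weight G y).
pose D N w := (rare_mean_est G V a (xi N) phi w - m) *
  \1_[set w' | 0 < rare_prob_est G V a (xi N) w'] w.
have bw (f : paths E n -> R) : bmeas f -> bmeas (fun y => f y * path_weight G y).
  by move=> bf; apply: bmeasM => //; exact: bmeas_path_weight.
have estE N f w : (0 < N)%N -> bmeas f ->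
    \int[empirical (fun i => xi N n i w)]_y rare_T G V a f y =
    e N (fun y => f y * one y) w.
  by move=> N0 bf; rewrite Exp_empirical//; exact/bw/bmeasM.
have est1 N w : (0 < N)%N ->
    \int[empirical (fun i => xi N n i w)]_y rare_T G V a (fun=> 1) y = e N one w.
  move=> N0; rewrite estE//; last exact: bmeas_cst.
  rewrite /e; congr (_ * _); apply: eq_bigr => i _; by rewrite mul1r.
have e_fm N w : e N fm w = e N (fun y => phi y * one y) w - m * e N one w.
  rewrite /e /emp_mean mulrCA -mulrBr; congr (_ * _).
  by rewrite mulr_sumr -sumrB; apply: eq_bigr => i _; rewrite /fm; ring.
(* [one] and [path_weight] are nonnegative, so |A| <= c B after averaging: this bounds the quotient
   by [c] however small B is. *)
have fm_le y : `|fm y * path_weight G y| <= c * (one y * path_weight G y).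
  rewrite /fm -mulrA normrM [`|one y * _|]ger0_norm ?ler_wpM2r//.
    by rewrite mulr_ge0 ?indicE//; exact/ltW/path_weight_gt0.
  by rewrite mulr_ge0 ?indicE//; exact/ltW/path_weight_gt0.
have e_le N w : (0 < N)%N -> `|e N fm w| <= c * e N one w.
  move=> N0; rewrite /e /emp_mean normrM ger0_norm ?invr_ge0 ?ler0n//.
  rewrite mulrCA ler_wpM2l ?invr_ge0 ?ler0n// mulr_sumr.
  by rewrite (le_trans (ler_norm_sum _ _ _))//; exact: ler_sum.
have e_ge0 N w : 0 <= e N one w.
  rewrite mulr_ge0 ?invr_ge0 ?ler0n//; apply: sumr_ge0 => i _.
  by rewrite mulr_ge0 ?indicE//; exact/ltW/path_weight_gt0.
have probE N w : (0 < N)%N ->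
    rare_prob_est G V a (xi N) w = e N one w * norm_est G (xi N) n w.
  move=> N0; rewrite /rare_prob_est est1//; congr (_ * _).
  rewrite /norm_est big_nat_cond [RHS]big_nat_cond; apply: eq_bigr => p.
  rewrite andbT => /andP[p0 _]; rewrite Exp_empirical//.
  exact: bmeas_potential.
(* [norm_est] is positive, so the indicator is 1 exactly where [e N one w] is nonzero; elsewhere
   both sides are 0, the right one because x / 0 = 0. *)
have DE N w : (0 < N)%N -> D N w = e N fm w / e N one w.
  move=> N0; rewrite /D /rare_mean_est estE// est1// indicE.
  have ng0 := norm_est_gt0 hG (xi N) N0 n w.
  have [e0|e0] := eqVneq (e N one w) 0.
    rewrite memNset ?mulr0 ?e0 ?invr0 ?mulr0//=.
    by rewrite probE// e0 mul0r ltxx.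
  rewrite mem_set ?mulr1/=; last by rewrite probE// mulr_gt0// lt0r e0 e_ge0.
  by rewrite e_fm; field.
(* n >= 1 rules out the time 0 branch of [weighted_est]. *)
have estW N (f : paths E n -> R) w : weighted_est P X G (xi N) f w =
    norm_est G (xi N) n w * e N f w by rewrite /weighted_est gtn_eqF.
have bEst N (f : paths E n -> R) : (0 < N)%N -> bmeas f ->
    bmeas (weighted_est P X G (xi N) f).
  by move=> N0 bf; exact: (bmeas_weighted_est hG (hxi _ N0) bf).
have e_bmeas N f : (0 < N)%N -> bmeas f -> bmeas (e N f).
  move=> N0 bf; apply: emp_mean_bmeas; last exact: bw.
  by move=> i; case: (hxi _ N0) => + _ _; apply.
have D_le N w : (0 < N)%N -> `|D N w| <= c.
  move=> N0; rewrite DE// normrM [`|_^-1|]ger0_norm ?invr_ge0//.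
  have [->|e0] := eqVneq (e N one w) 0; first by rewrite invr0 mulr0; lra.
  by rewrite ler_pdivrMr ?e_le// lt0r e0 e_ge0.
have bD N : (0 < N)%N -> bmeas (D N).
  move=> N0; split; last by exists c => w; exact: D_le.
  rewrite (_ : D N = fun w => e N fm w * (e N one w)^-1); last first.
    by apply/funext => w; rewrite DE.
  apply: measurable_funM; first by case: (e_bmeas N _ N0 bfm).
  by apply: measurable_inv_ge0 => //; case: (e_bmeas N _ N0 bone).
have ADB N w : (0 < N)%N -> weighted_est P X G (xi N) fm w =
    D N w * weighted_est P X G (xi N) one w.
  move=> N0; rewrite DE// !estW.
  (* Where the denominator vanishes, [e_le] forces the numerator to vanish too, so A = D B
     persists. *)
  have [e0|e0] := eqVneq (e N one w) 0; last by field.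
  have := e_le N w N0; rewrite e0 mulr0 normr_le0 => /eqP ->.
  by rewrite mulr0 !mul0r.
have [CA HA] := weighted_est_moment4 hX hG hxi bfm.
have [CB HB] := weighted_est_moment4 hX hG hxi bone.
rewrite pione in HB; rewrite pifm in HA.
have cov := weighted_est_cov hX hG hxi bfm bone.
rewrite pifm mul0r in cov.
have {}cov : (fun N => N%:R * \int[PU N]_w (weighted_est P X G (xi N) fm w *
    weighted_est P X G (xi N) one w)) @ \oo --> asymp_cov K P X G fm one.
  by under eq_fun do rewrite -[X in _ * X]subr0.
have {}HA N : (0 < N)%N -> \int[PU N]_w weighted_est P X G (xi N) fm w ^+ 4 <=
    CA / N%:R ^+ 2.
  move=> /HA; by under eq_Rintegral do rewrite subr0.
(* Positivity of gamma_p^-(1), needed to turn gamma_p^-(1) eta_p^-(h) into gamma_p^-(h). *)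
have pw_mean_gt0 p : 0 < path_mean P X (fun y : paths E p => path_weight G y).
  have [C C1 wC] := bmeas_boundP (bmeas_path_weightV hG p).
  have C0 : 0 < C by exact: lt_le_trans C1.
  apply: (@lt_le_trans _ _ C^-1); first by rewrite invr_gt0.
  rewrite -[leLHS](Exp_cst P1); apply: le_Exp => //; first exact: bmeas_cst.
    apply: (bmeas_comp (measurable_hist (n := p) mX)); exact: bmeas_path_weight.
  move=> w; have w0 := path_weight_gt0 hG (hist X p w).
  rewrite -[leRHS]invrK lef_pV2 ?posrE ?invr_gt0//.
  exact: le_trans (ler_norm _) (wC _).
have SE : asymp_cov K P X G fm one = \sum_(1 <= p < n.+1)
      FKgamma P X G (fun _ : paths E p => 1) *
      FKgamma P X (pot_inv G) (fun _ : paths E p => 1) *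
      FKeta P X (pot_inv G)
        (fun y : paths E p => cond_prob K V a y * cond_mean K P X V a phi y).
  rewrite /asymp_cov pifm mul0r big_nat_cond [RHS]big_nat_cond; apply: eq_bigr => p.
  rewrite andbT ltnS => /andP[_ pn]; rewrite subr0 /FKeta.
  have cancel (x y z : R) : y != 0 -> x * y * (z / y) = x * z.
    by move=> y0; field.
  rewrite cancel; last first.
    rewrite FKgamma_invE gt_eqF//.
    rewrite (_ : (fun y => _) = fun y : paths E p => path_weight G y)//.
    by apply/funext => y; rewrite mul1r.
  rewrite FKgammaE FKgamma_invE; congr (_ * _); apply: eq_Rintegral => w _.
    by rewrite mul1r.
  rewrite /cond_prob (kexp_plast _ _ bL)// /cond_mean.
  by rewrite -mulrA mulrC [X in X * _]mulrC.
rewrite -SE.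
have lim := cvg_ratio_bias ha (fun N N0 => And3 (bEst N _ N0 bfm) (bEst N _ N0 bone)
  (bD N N0)) ADB D_le _ HA HB cov.
rewrite unlock; apply: lim => N N0.
by rewrite (Exp_weighted_est hX hG N0 (hxi _ N0)).
Qed.
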